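(* There is an algorithm which, given any bounded $\mathcal{L}_{\mathcal{F}}$-sentence $\varphi$ and any $\delta\in\mathbb{Q}^+$, halts and correctly returns one of the following two answers: ''True'', which may be returned only if $\varphi$ is true; or ''$\delta$-False'', which may be returned only if $\varphi^{+\delta}$ is false. (If both $\varphi$ is true and $\varphi^{+\delta}$ is false, either answer is allowed.)
   Context: A function $f:\subseteq\mathbb{R}^n\to\mathbb{R}$ is (Type 2) computable if there is a function-oracle Turing machine $M$ outputting dyadic rationals such that for every $\vec x\in\mathrm{dom}(f)$, every name $\gamma$ of $\vec x$ (a map $\gamma:\mathbb{N}\to$ dyadic rationals with $|\gamma(i)-x|<2^{-i}$ for all $i$, componentwise for vectors) and every $i$, $|M^{\gamma}(i)-f(\vec x)|<2^{-i}$. $\mathcal{F}$ is an arbitrary collection of function symbols, each denoting a Type 2 computable real function (constants are $0$-ary functions), containing at least $0$, unary negation, addition, absolute value, and all rational constants. $\mathcal{L}_{\mathcal{F}}$ has signature $\langle\mathcal{F},>\rangle$, interpreted over $\mathbb{R}$. Terms are variables and $f(t_1,\dots,t_n)$, $f\in\mathcal{F}$. Formulas: $t>0$, $t\ge0$, $\wedge$, $\vee$, $\exists$, $\forall$ (no primitive negation); $\neg\varphi$ replaces atoms $t>0$ by $-t\ge0$ and $t\ge0$ by $-t>0$ and switches $\wedge/\vee$ and $\exists/\forall$; $\varphi_1\rightarrow\varphi_2$ abbreviates $\neg\varphi_1\vee\varphi_2$; $s\le t$ abbreviates $t-s\ge0$. Bounded quantifiers: $\exists^{[u,v]}x.\varphi:=\exists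 x.(u\le x\wedge x\le v\wedge\varphi)$, $\forall^{[u,v]}x.\varphi:=\forall x.((u\le x\wedge x\le v)\rightarrow\varphi)$, with $u,v$ terms whose variables are among the free variables of $\varphi$ other than $x$. A bounded $\mathcal{L}_{\mathcal{F}}$-sentence is $Q_1^{[u_1,v_1]}x_1\cdots Q_n^{[u_n,v_n]}x_n.\psi$ with $\psi$ a positive Boolean combination of atoms $t_1>0,\dots,t_k>0,t_{k+1}\ge0,\dots,t_m\ge0$. For $\delta\in\mathbb{Q}^+\cup\{0\}$, the $\delta$-strengthening $\varphi^{+\delta}$ replaces each atom $t_i>0$ by $t_i>\delta$ and each $t_j\ge0$ by $t_j\ge\delta$ (quantifier bounds unchanged).
   Formalization: The sentence is assumed meaningful: all its terms are defined as the variables range over their intervals, and u ≤ v for every quantifier interval [u,v] (with empty intervals the claim is false); each function symbol is given to the algorithm by a machine computing it. *)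

(* Defs.v *)
From HB Require Import structures.
From mathcomp Require Import all_boot all_order all_algebra.
From mathcomp Require Import classical_sets reals.
Set Implicit Arguments.
Unset Strict Implicit.
Unset Printing Implicit Defensive.
Import Order.TTheory GRing.Theory Num.Theory.
Local Open Scope ring_scope.

(* Argument lists are untyped: a missing argument reads as 0, except that
   primitive recursion on an empty list is undefined. *)
Inductive recfun : Type :=
| RZero
| RSucc
| RProj of nat
| RComp of recfun & seq recfun
| RPrim of recfun & recfun
| RMu of recfun.

(* [reval e xs y]: the function e, applied to xs, halts with value y. *)
Inductive reval : recfun -> seq nat -> nat -> Prop :=
| reval_zero xs : reval RZero xs 0%N
| reval_succ xs : reval RSucc xs (nth 0%N xs 0).+1
| reval_proj i xs : reval (RProj i) xs (nth 0%N xs i)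
| reval_comp f gs xs ys y :
    revals gs xs ys -> reval f ys y -> reval (RComp f gs) xs y
| reval_prim0 f g xs y :
    reval f xs y -> reval (RPrim f g) (0%N :: xs) y
| reval_primS f g n xs r y :
    reval (RPrim f g) (n :: xs) r -> reval g [:: n, r & xs] y ->
    reval (RPrim f g) (n.+1 :: xs) y
| reval_mu f xs n (h : nat -> nat) :
    (forall m, (m < n)%N -> reval f (m :: xs) (h m).+1) ->
    reval f (n :: xs) 0%N -> reval (RMu f) xs n
with revals : seq recfun -> seq nat -> seq nat -> Prop :=
| revals_nil xs : revals [::] xs [::]
| revals_cons g gs xs y ys :
    reval g xs y -> revals gs xs ys -> revals (g :: gs) xs (y :: ys).

(* A machine has a work tape and a query tape.  States and tape symbols are
   numbers; those that matter are the finitely many occurring in the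
   instruction table.  The machine starts in state 0 and halts when no
   instruction applies; if several apply, the first one in the table is used.
   State 1 is the query state and state 2 the answer state. *)
Inductive move := MoveL | MoveN | MoveR.

Record instr := Instr {
  i_state : nat; i_work : nat; i_query : nat;
  o_state : nat; o_work : nat; o_query : nat;
  o_mwork : move; o_mquery : move }.

Definition otm := seq instr.

(* (l, r) is the two-way infinite tape ... 0 0 (rev l) r 0 0 ...  whose head
   is on the first cell of r; symbol 0 is the blank. *)
Definition tape := (seq nat * seq nat)%type.
Definition tape_read (t : tape) : nat := head 0%N t.2.
Definition tape_write (s : nat) (t : tape) : tape := (t.1, s :: behead t.2).
Definition tape_move (m : move) (t : tape) : tape :=
  match m with
  | MoveL => (behead t.1, head 0%N t.1 :: t.2)
  | MoveN => t
  | MoveR => (head 0%N t.2 :: t.1, behead t.2)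
  end.

Record config := Config { c_state : nat; c_work : tape; c_query : tape }.

Definition start_state : nat := 0.
Definition query_state : nat := 1.
Definition answer_state : nat := 2.

Definition applicable (c : config) (a : instr) : bool :=
  [&& i_state a == c_state c, i_work a == tape_read (c_work c)
    & i_query a == tape_read (c_query c)].

(* A query is posed in unary: its argument is the number of symbols 1 on the
   query tape, whose content is then replaced by the answer, with the head on
   its first symbol. *)
Definition step (orc : nat -> seq nat) (M : otm) (c : config) : option config :=
  if c_state c == query_state then
    let i := count_mem 1%N ((c_query c).1 ++ (c_query c).2) in
    Some (Config answer_state (c_work c) ([::], orc i))
  else
    if [seq a <- M | applicable c a] is a :: _ then
      Some (Config (o_state a)
        (tape_move (o_mwork a) (tape_write (o_work a) (c_work c)))
        (tape_move (o_mquery a) (tape_write (o_query a) (c_query c))))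
    else None.

(* The halting configuration, if it is reached from c in at most k steps. *)
Fixpoint run (orc : nat -> seq nat) (M : otm) (k : nat) (c : config)
    : option config :=
  match step orc M c, k with
  | None, _ => Some c
  | Some c', k'.+1 => run orc M k' c'
  | Some _, 0 => None
  end.

(* The input i is given in unary on the work tape. *)
Definition start_config (i : nat) : config :=
  Config start_state ([::], nseq i 1%N) ([::], [::]).

(* The output is the blank-free word starting at the work tape's head. *)
Definition output (c : config) : seq nat :=
  let r := (c_work c).2 in take (index 0%N r) r.

Definition otm_outputs (M : otm) (orc : nat -> seq nat) (i : nat)
    (w : seq nat) : Prop :=
  exists k c, run orc M k (start_config i) = Some c /\ output c = w.

Definition dyadic (q : rat) : Prop :=
  exists (m : int) (k : nat), q = m%:~R / 2 ^+ k.

(* Binary digits, least significant first (k is fuel); the digit 1 is the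
   symbol 1 and the digit 0 is the symbol 2. *)
Fixpoint bits_rec (k n : nat) : seq nat :=
  if k is k'.+1 then
    if n == 0%N then [::] else (if odd n then 1%N else 2%N) :: bits_rec k' n./2
  else [::].
Definition bits (n : nat) : seq nat := bits_rec n n.

(* The word for the dyadic m / 2^k in lowest terms: an optional minus sign
   (symbol 3), then m and k in binary, each closed by the separator 4. *)
Definition dyadic_word (q : rat) : seq nat :=
  (if q < 0 then [:: 3%N] else [::])
    ++ bits `|numq q|%N ++ [:: 4%N] ++ bits (logn 2 `|denq q|%N) ++ [:: 4%N].

Definition name_oracle (n : nat) (g : nat -> 'rV[rat]_n) (i : nat) : seq nat :=
  flatten [seq dyadic_word (g i 0 j) | j <- enum 'I_n].

Definition is_name (R : realType) (n : nat) (x : 'rV[R]_n)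
    (g : nat -> 'rV[rat]_n) : Prop :=
  forall i j, dyadic (g i 0 j) /\ `|ratr (g i 0 j) - x 0 j| < 2 ^- i.

(* M computes the partial function R^n -> R given by f on the domain D. *)
Definition type2_computes (R : realType) (n : nat) (M : otm)
    (D : set 'rV[R]_n) (f : 'rV[R]_n -> R) : Prop :=
  forall x, D x -> forall g, is_name x g -> forall i,
    exists q, [/\ dyadic q, otm_outputs M (name_oracle g) i (dyadic_word q)
                & `|ratr q - f x| < 2 ^- i].

(* [symb n] is the collection of n-ary symbols; f denotes the partial function
   with domain [fdom f] and values [fval f x] there.  The constant 0 is
   [sym_rat 0]. *)
Record language (R : realType) := Language {
  symb : nat -> Type;
  fdom : forall n, symb n -> set 'rV[R]_n;
  fval : forall n, symb n -> 'rV[R]_n -> R;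
  sym_rat : rat -> symb 0;
  sym_neg : symb 1;
  sym_add : symb 2;
  sym_abs : symb 1;
  sym_ratP : forall q x, fdom (sym_rat q) x /\ fval (sym_rat q) x = ratr q;
  sym_negP : forall x, fdom sym_neg x /\ fval sym_neg x = - x 0 0;
  sym_addP : forall x, fdom sym_add x /\ fval sym_add x = x 0 0 + x 0 1;
  sym_absP : forall x, fdom sym_abs x /\ fval sym_abs x = `|x 0 0| }.

Section Syntax.
Variables (R : realType) (F : language R).

Inductive term : Type :=
| Var of nat
| App (n : nat) (f : symb F n) (ts : 'I_n -> term).

Definition tconst (q : rat) : term := App (sym_rat F q) (fun=> Var 0).
Definition tneg (t : term) : term := App (sym_neg F) (fun=> t).
Definition tadd (s t : term) : term :=
  App (sym_add F) (fun i : 'I_2 => if i == 0 then s else t).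
Definition tsub (s t : term) : term := tadd s (tneg t).

Inductive formula : Type :=
| Gt0 of term
| Ge0 of term
| And of formula & formula
| Or of formula & formula
| Ex of nat & formula
| All of nat & formula.

Fixpoint Neg (p : formula) : formula :=
  match p with
  | Gt0 t => Ge0 (tneg t)
  | Ge0 t => Gt0 (tneg t)
  | And p1 p2 => Or (Neg p1) (Neg p2)
  | Or p1 p2 => And (Neg p1) (Neg p2)
  | Ex x p1 => All x (Neg p1)
  | All x p1 => Ex x (Neg p1)
  end.

Definition Imp (p1 p2 : formula) : formula := Or (Neg p1) p2.
Definition Le (s t : term) : formula := Ge0 (tsub t s).

Definition BEx (x : nat) (u v : term) (p : formula) : formula :=
  Ex x (And (And (Le u (Var x)) (Le (Var x) v)) p).
Definition BAll (x : nat) (u v : term) (p : formula) : formula :=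
  All x (Imp (And (Le u (Var x)) (Le (Var x) v)) p).

Fixpoint tvars (t : term) : seq nat :=
  match t with
  | Var x => [:: x]
  | App n f ts => flatten [seq tvars (ts i) | i <- enum 'I_n]
  end.

Fixpoint fvars (p : formula) : seq nat :=
  match p with
  | Gt0 t | Ge0 t => tvars t
  | And p1 p2 | Or p1 p2 => fvars p1 ++ fvars p2
  | Ex x p1 | All x p1 => [seq y <- fvars p1 | y != x]
  end.

Fixpoint qfree (p : formula) : bool :=
  match p with
  | Gt0 _ | Ge0 _ => true
  | And p1 p2 | Or p1 p2 => qfree p1 && qfree p2
  | Ex _ _ | All _ _ => false
  end.

(* A prefix of bounded quantifiers over a matrix; it is kept apart from the
   formula that it abbreviates because strengthening leaves the atoms coming
   from the quantifier bounds untouched. *)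
Inductive bform : Type :=
| Matrix of formula
| QEx (x : nat) (u v : term) of bform
| QAll (x : nat) (u v : term) of bform.

Fixpoint to_formula (b : bform) : formula :=
  match b with
  | Matrix p => p
  | QEx x u v b1 => BEx x u v (to_formula b1)
  | QAll x u v b1 => BAll x u v (to_formula b1)
  end.

Fixpoint bform_wf (b : bform) : Prop :=
  match b with
  | Matrix p => qfree p
  | QEx x u v b1 | QAll x u v b1 =>
      {subset tvars u ++ tvars v <= [seq y <- fvars (to_formula b1) | y != x]}
      /\ bform_wf b1
  end.

Definition bounded_sentence (b : bform) : Prop :=
  bform_wf b /\ fvars (to_formula b) = [::].

Fixpoint strengthen_matrix (d : rat) (p : formula) : formula :=
  match p with
  | Gt0 t => Gt0 (tsub t (tconst d))
  | Ge0 t => Ge0 (tsub t (tconst d))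
  | And p1 p2 => And (strengthen_matrix d p1) (strengthen_matrix d p2)
  | Or p1 p2 => Or (strengthen_matrix d p1) (strengthen_matrix d p2)
  | Ex x p1 => Ex x (strengthen_matrix d p1)
  | All x p1 => All x (strengthen_matrix d p1)
  end.

Fixpoint strengthen (d : rat) (b : bform) : bform :=
  match b with
  | Matrix p => Matrix (strengthen_matrix d p)
  | QEx x u v b1 => QEx x u v (strengthen d b1)
  | QAll x u v b1 => QAll x u v (strengthen d b1)
  end.

Definition env := nat -> R.
Definition upd (e : env) (x : nat) (a : R) : env :=
  fun y => if y == x then a else e y.

(* Meaningful only where [tdef] holds. *)
Fixpoint tval (e : env) (t : term) : R :=
  match t with
  | Var x => e x
  | App n f ts => fval f (\row_i tval e (ts i))
  end.

Fixpoint tdef (e : env) (t : term) : Prop :=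
  match t with
  | Var x => True
  | App n f ts => (forall i, tdef e (ts i)) /\ fdom f (\row_i tval e (ts i))
  end.

Fixpoint holds (e : env) (p : formula) : Prop :=
  match p with
  | Gt0 t => 0 < tval e t
  | Ge0 t => 0 <= tval e t
  | And p1 p2 => holds e p1 /\ holds e p2
  | Or p1 p2 => holds e p1 \/ holds e p2
  | Ex x p1 => exists a, holds (upd e x a) p1
  | All x p1 => forall a, holds (upd e x a) p1
  end.

(* Intended for sentences, where the environment is irrelevant. *)
Definition bform_true (b : bform) : Prop := holds (fun=> 0) (to_formula b).

Fixpoint matrix_def (e : env) (p : formula) : Prop :=
  match p with
  | Gt0 t | Ge0 t => tdef e t
  | And p1 p2 | Or p1 p2 => matrix_def e p1 /\ matrix_def e p2
  | Ex x p1 | All x p1 => forall a, matrix_def (upd e x a) p1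
  end.

(* All bounds and all atoms are defined as the quantified variables range over
   their intervals.  Without this an atom need not have a truth value, the
   symbols being interpreted by partial functions. *)
Fixpoint terms_defined (e : env) (b : bform) : Prop :=
  match b with
  | Matrix p => matrix_def e p
  | QEx x u v b1 | QAll x u v b1 =>
      [/\ tdef e u, tdef e v
        & forall a, tval e u <= a <= tval e v -> terms_defined (upd e x a) b1]
  end.

(* Each [u, v] is an interval, u <= v, as the outer variables range over
   theirs.  Otherwise the sentence exists x in [0, c], 1 > 0 and its
   1/2-strengthening both express 0 <= c, which is undecidable for computable
   reals c. *)
Fixpoint proper_intervals (e : env) (b : bform) : Prop :=
  match b with
  | Matrix p => True
  | QEx x u v b1 | QAll x u v b1 =>
      tval e u <= tval e v /\
      forall a, tval e u <= a <= tval e v -> proper_intervals (upd e x a) b1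
  end.

Definition meaningful (b : bform) : Prop :=
  terms_defined (fun=> 0) b /\ proper_intervals (fun=> 0) b.

End Syntax.

(* [CodeSeq.code] is MathComp's bijection from seq nat to nat. *)
Definition code_move (m : move) : nat :=
  match m with MoveL => 0 | MoveN => 1 | MoveR => 2 end.

Definition code_instr (a : instr) : nat :=
  CodeSeq.code [:: i_state a; i_work a; i_query a; o_state a; o_work a;
                   o_query a; code_move (o_mwork a); code_move (o_mquery a)].

Definition code_otm (M : otm) : nat := CodeSeq.code (map code_instr M).

Definition code_int (z : int) : nat :=
  match z with Posz n => n.*2 | Negz n => n.*2.+1 end.

Definition code_rat (q : rat) : nat :=
  CodeSeq.code [:: code_int (numq q); code_int (denq q)].

Section Code.
Variables (R : realType) (F : language R).
(* Function symbols are presented to an algorithm by machines computing their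
   denotations: F is an arbitrary, possibly uncountable, collection. *)
Variable mach : forall n, symb F n -> otm.

Fixpoint code_term (t : term F) : nat :=
  match t with
  | Var x => CodeSeq.code [:: 0%N; x]
  | App n f ts =>
      CodeSeq.code [:: 1%N, code_otm (mach f)
                     & [seq code_term (ts i) | i <- enum 'I_n]]
  end.

Fixpoint code_formula (p : formula F) : nat :=
  match p with
  | Gt0 t => CodeSeq.code [:: 0%N; code_term t]
  | Ge0 t => CodeSeq.code [:: 1%N; code_term t]
  | And p1 p2 => CodeSeq.code [:: 2%N; code_formula p1; code_formula p2]
  | Or p1 p2 => CodeSeq.code [:: 3%N; code_formula p1; code_formula p2]
  | Ex x p1 => CodeSeq.code [:: 4%N; x; code_formula p1]
  | All x p1 => CodeSeq.code [:: 5%N; x; code_formula p1]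
  end.

Fixpoint code_bform (b : bform F) : nat :=
  match b with
  | Matrix p => CodeSeq.code [:: 0%N; code_formula p]
  | QEx x u v b1 =>
      CodeSeq.code [:: 1%N; x; code_term u; code_term v; code_bform b1]
  | QAll x u v b1 =>
      CodeSeq.code [:: 2%N; x; code_term u; code_term v; code_bform b1]
  end.

End Code.

(* Main.v *)
Require Import Defs.
From mathcomp Require Import all_boot all_order all_algebra.
From mathcomp Require Import classical_sets reals.
From mathcomp Require Import boolp ring lra zify.
Import Defs.
Set Implicit Arguments.
Unset Strict Implicit.
Unset Printing Implicit Defensive.
Import Order.TTheory GRing.Theory Num.Theory.

(* Judgements "this sentence holds at every admissible point of this rational
   box" and "its delta-strengthening fails there" are given finite certificates.
   A term is enclosed on a box by running its machines on finite oracles whose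
   words are valid approximations of every point of the box; a quantifier ranging
   over [u, v] is certified by one interval meeting every [u(e), v(e)], or by a
   chain of intervals covering all of them.  Certificates are sound.  Conversely,
   at a fixed point either the sentence holds with all atoms t > 0, or the dual
   formula with all atoms t < delta does, and each of these strict statements has
   a certificate on every small enough box around the point, since machines query
   only finitely many oracle values and [u, v] is compact.

   The certificates are the derivations of a finite program of Horn clauses over
   the natural numbers, seen as lists through [CodeSeq.code]; the algorithm is a
   mu-search for the code of a derivation of either verdict. *)

(** * Computable functions of a fixed arity *)

(** The obstacle is that no comparison of reals can be decided, so no recursion on the formula can
    choose between the verdicts. The gap delta removes the need to choose: as delta > 0, every value
    satisfies t > 0 or t < delta, both conditions are open, and this dichotomy passes through
    connectives and quantifiers by excluded middle. A certificate for at least one verdict thus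
    exists without any procedure saying for which, and a blind search ends. Clauses replace direct
    programming because whatever must be guessed (endpoints, precisions, oracle words, lengths of
    runs, subdivisions) becomes a variable of a clause. Only the checking of proofs then has to be
    shown recursive, once for all programs. One run speaks for a whole box because its finite list
    of oracle words extends to a name of each point of the box, and a halting machine sees nothing
    beyond that list. Nonemptiness of the intervals enters when a witness is produced: overlap of
    two intervals can be read from their endpoints only if both are nonempty. *)

Definition computable (k : nat) (f : seq nat -> nat) : Prop :=
  exists e, forall xs, size xs = k -> reval e xs (f xs).

Definition decided (k : nat) (p : seq nat -> bool) : Prop :=
  computable k (fun xs => p xs : nat).

Lemma computable_ext k f g :
  (forall xs, size xs = k -> f xs = g xs) -> computable k f -> computable k g.
Proof. by move=> fg [e eP]; exists e => xs sz; rewrite -fg //; apply: eP. Qed.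

Lemma computable_arg k i : computable k (fun xs => nth 0 xs i).
Proof. by exists (RProj i) => xs _; constructor. Qed.

(** The hypothesis is folded over [gs], so for an explicit list it reduces to one conjunct per
    argument function. *)
Lemma computable_comp k f (gs : seq (seq nat -> nat)) :
  computable (size gs) f -> foldr (fun g P => computable k g /\ P) True gs ->
  computable k (fun xs => f [seq g xs | g <- gs]).
Proof.
move=> [e eP] gsP.
have [es esP]: exists es, forall xs, size xs = k ->
    revals es xs [seq g xs | g <- gs].
  elim: gs gsP {eP} => [_|g gs IH /= [[a aP] /IH[es esP]]].
    by exists [::] => xs _; constructor.
  by exists (a :: es) => xs sz; constructor; [apply: aP|apply: esP].
exists (RComp e es) => xs sz; apply: reval_comp; first exact: esP.
by apply: eP; rewrite size_map.
Qed.

Lemma computable_args k m n :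
  foldr (fun g P => computable k g /\ P) True
    [seq (fun xs => nth 0 xs i) | i <- iota m n].
Proof. by elim: n m => //= n IH m; split; [exact: computable_arg|exact: IH]. Qed.

Lemma computable_app1 k f g :
  computable 1 (fun xs => f (nth 0 xs 0)) -> computable k g ->
  computable k (fun xs => f (g xs)).
Proof. by move=> hf hg; apply: (@computable_comp k _ [:: g] hf). Qed.

Lemma computable_app2 k f g h :
  computable 2 (fun xs => f (nth 0 xs 0) (nth 0 xs 1)) ->
  computable k g -> computable k h -> computable k (fun xs => f (g xs) (h xs)).
Proof. by move=> hf hg hh; apply: (@computable_comp k _ [:: g; h] hf). Qed.

Lemma computable_succ k f : computable k f -> computable k (fun xs => (f xs).+1).
Proof. by move=> /(computable_app1 _); apply; exists RSucc => xs _;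
  constructor. Qed.

Lemma computable_const k c : computable k (fun=> c).
Proof.
elim: c => [|c]; last exact: computable_succ.
by exists RZero => xs _; constructor.
Qed.

(** [RPrim] recurses on the first entry of its list, so [m] is put in front of k projections that
    copy the list; the fixed length k is what makes finitely many projections enough. *)
Lemma computable_rec k b s m :
  computable k b -> computable k.+2 s -> computable k m ->
  computable k (fun xs => nat_rect (fun=> nat) (b xs)
                            (fun n r => s [:: n, r & xs]) (m xs)).
Proof.
move=> [eb ebP] [es esP] hm.
pose rc xs := nat_rect (fun=> nat) (b (behead xs))
  (fun n r => s [:: n, r & behead xs]) (head 0 xs).
pose args := [seq (fun xs => nth 0 xs i) | i <- iota 0 k].
have hrc : computable (size (m :: args)) rc.
  exists (RPrim eb es) => -[|x xs] //=; rewrite size_map size_iota => -[sz].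
  rewrite /rc /=; elim: x => [|x IH] /=; first by apply/reval_prim0/ebP.
  by apply: reval_primS IH _; apply: esP => /=; rewrite sz.
apply: computable_ext (computable_comp hrc (conj hm (computable_args k 0 k))).
move=> xs sz; rewrite /rc /= -map_comp /=.
suff -> : [seq nth 0 xs i | i <- iota 0 k] = xs by [].
by rewrite -[RHS](mkseq_nth 0) /mkseq sz.
Qed.

Lemma computable_add k f g :
  computable k f -> computable k g -> computable k (fun xs => f xs + g xs).
Proof.
move=> hf hg; have hs : computable k.+2 (fun xs => (nth 0 xs 1).+1).
  exact/computable_succ/computable_arg.
apply: computable_ext (computable_rec hg hs hf) => xs _ /=.
by elim: (f xs) => //= n ->; rewrite addSn.
Qed.

Lemma computable_mul k f g :
  computable k f -> computable k g -> computable k (fun xs => f xs * g xs).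
Proof.
move=> hf hg; apply: (computable_app2 _ hf hg).
have hs : computable 4 (fun xs => nth 0 xs 3 + nth 0 xs 1).
  by apply: computable_add; apply: computable_arg.
apply: computable_ext (computable_rec (computable_const 2 0) hs
  (computable_arg 2 0)) => xs _ /=.
by elim: (nth 0 xs 0) => //= n ->; rewrite mulSn.
Qed.

Lemma computable_exp2 k f : computable k f -> computable k (fun xs => 2 ^ f xs).
Proof.
move=> hf.
have hs : computable k.+2 (fun xs => 2 * nth 0 xs 1).
  by apply: computable_mul; [apply: computable_const|apply: computable_arg].
apply: computable_ext (computable_rec (computable_const k 1) hs hf) => xs _ /=.
by elim: (f xs) => //= n ->; rewrite expnS.
Qed.

Lemma computable_sub k f g :
  computable k f -> computable k g -> computable k (fun xs => f xs - g xs).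
Proof.
move=> hf hg.
(* The predecessor is a recursion whose step forgets the previous value and returns the counter;
   truncated subtraction iterates it. *)
have hp : computable 1 (fun xs => (nth 0 xs 0).-1).
  apply: computable_ext (computable_rec (computable_const 1 0)
    (computable_arg 3 0) (computable_arg 1 0)) => xs _ /=.
  by case: (nth 0 xs 0).
have hs : computable k.+2 (fun xs => (nth 0 xs 1).-1).
  by apply: (computable_app1 hp); apply: computable_arg.
apply: computable_ext (computable_rec hf hs hg) => xs _ /=.
by elim: (g xs) => [|n /= ->]; rewrite ?subn0 // subnS.
Qed.

Lemma decided_neg k p : decided k p -> decided k (fun xs => ~~ p xs).
Proof.
move=> hp; apply: computable_ext (computable_sub (computable_const k 1) hp).
by move=> xs _; case: (p xs).
Qed.

Lemma decided_and k p q :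
  decided k p -> decided k q -> decided k (fun xs => p xs && q xs).
Proof.
move=> hp hq; apply: computable_ext (computable_mul hp hq).
by move=> xs _; rewrite mulnb.
Qed.

Lemma decided_or k p q :
  decided k p -> decided k q -> decided k (fun xs => p xs || q xs).
Proof.
move=> hp hq; apply: computable_ext (decided_neg
  (decided_and (decided_neg hp) (decided_neg hq))).
by move=> xs _; rewrite negb_and !negbK.
Qed.

(** With truncated subtraction, (f - g) + (g - f) vanishes exactly when f = g. *)
Lemma decided_eq k f g :
  computable k f -> computable k g -> decided k (fun xs => f xs == g xs).
Proof.
move=> hf hg; apply: computable_ext (computable_sub (computable_const k 1)
  (computable_add (computable_sub hf hg) (computable_sub hg hf))).
by move=> xs _; case: eqP; lia.
Qed.

(** Inside a recursion step the list is counter, accumulator, parameters. This applies f to the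
    parameters preceded by the counter (j = 0) or by the accumulator (j = 1). *)
Lemma computable_drop2 k f j : computable k.+1 f ->
  computable k.+2 (fun xs => f (nth 0 xs j :: drop 2 xs)).
Proof.
move=> hf.
pose gs := (fun xs => nth 0 xs j) ::
  [seq (fun xs => nth 0 xs i) | i <- iota 2 k].
have hgs : computable (size gs) f by rewrite /= size_map size_iota.
apply: computable_ext (computable_comp hgs (conj (computable_arg k.+2 j)
  (computable_args k.+2 2 k))) => xs sz /=.
rewrite -map_comp; congr (f (_ :: _)).
apply: (@eq_from_nth _ 0) => [|i].
  by rewrite size_map size_iota size_drop sz subSS subSS subn0.
rewrite size_map size_iota => ik.
by rewrite (nth_map 0) ?size_iota // nth_iota // nth_drop.
Qed.

Lemma decided_has k p m : decided k.+1 p -> computable k m ->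
  decided k (fun xs => has (fun i => p (i :: xs)) (iota 0 (m xs))).
Proof.
move=> hp hm.
have hs : decided k.+2 (fun xs => (nth 0 xs 1 != 0)
    || p (nth 0 xs 0 :: drop 2 xs)).
  apply: decided_or; last exact: computable_drop2 hp.
  apply/decided_neg/decided_eq; first exact: computable_arg.
  exact: computable_const.
apply: computable_ext (computable_rec (computable_const k 0) hs hm) => xs _.
elim: (m xs) => // n IH; rewrite [LHS]/= {}IH [LHS]/= drop0.
rewrite -[in RHS]addn1 iotaD has_cat /= orbF.
by case: (has _ _).
Qed.

Lemma computable_find k p m : decided k.+1 p -> computable k m ->
  computable k (fun xs => find (fun i => p (i :: xs)) (iota 0 (m xs))).
Proof.
move=> hp hm.
(* The accumulator is the current candidate: it advances while [p] fails on it and stays put once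
   [p] holds. *)
have hs : computable k.+2 (fun xs => nth 0 xs 1
    + ~~ p (nth 0 xs 1 :: drop 2 xs)).
  apply: computable_add; first exact: computable_arg.
  apply: decided_neg; exact: computable_drop2 hp.
apply: computable_ext (computable_rec (computable_const k 0) hs hm) => xs _.
elim: (m xs) => // n IH; rewrite [LHS]/= {}IH [LHS]/= drop0.
rewrite -[in RHS]addn1 iotaD find_cat; case: ifPn => hn.
  have lt : find (fun i => p (i :: xs)) (iota 0 n) < n.
    by rewrite -[X in _ < X](size_iota 0 n) -has_find.
  by have := nth_find 0 hn; rewrite nth_iota // add0n => ->; rewrite addn0.
rewrite hasNfind // size_iota /= add0n; by case: (p _).
Qed.

(** * The list structure of the natural numbers *)

(** The cons of [CodeSeq.code]. It is never 0, so 0 is the empty list and each positive number is a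
    pair in exactly one way. *)
Definition npair (a b : nat) : nat := 2 ^ a * b.*2.+1.
Definition nhead (n : nat) : nat := head 0 (CodeSeq.decode n).
Definition ntail (n : nat) : nat := CodeSeq.code (behead (CodeSeq.decode n)).

Lemma code_cons a s : CodeSeq.code (a :: s) = npair a (CodeSeq.code s).
Proof. by []. Qed.

Lemma decode_npair a b : CodeSeq.decode (npair a b) = a :: CodeSeq.decode b.
Proof. by rewrite -[b in LHS]CodeSeq.decodeK -code_cons CodeSeq.codeK. Qed.

Lemma decode0 : CodeSeq.decode 0 = [::].
Proof. by []. Qed.

Lemma npair_gt0 a b : 0 < npair a b.
Proof. by rewrite muln_gt0 expn_gt0. Qed.

Lemma nhead_cons a b : nhead (npair a b) = a.
Proof. by rewrite /nhead decode_npair. Qed.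

Lemma ntail_cons a b : ntail (npair a b) = b.
Proof. by rewrite /ntail decode_npair /= CodeSeq.decodeK. Qed.

Lemma npair_inj a b c d : npair a b = npair c d -> a = c /\ b = d.
Proof.
move=> E; split; first by rewrite -[LHS](nhead_cons a b) E nhead_cons.
by rewrite -[LHS](ntail_cons a b) E ntail_cons.
Qed.

Lemma npair_split n : 0 < n -> n = npair (nhead n) (ntail n).
Proof.
rewrite -{1 2}[n]CodeSeq.decodeK /nhead /ntail.
by case: (CodeSeq.decode n) => //= a s; rewrite code_cons.
Qed.

Lemma ltn_npair_l a b : a < npair a b.
Proof. by rewrite -[a.+1]muln1 leq_mul // ltn_expl. Qed.

Lemma ltn_npair_r a b : b < npair a b.
Proof. by rewrite -[b.+1]mul1n leq_mul ?expn_gt0 //; lia. Qed.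

Lemma computable_npair k f g :
  computable k f -> computable k g -> computable k (fun xs => npair (f xs) (g
    xs)).
Proof.
move=> hf hg; apply: computable_mul; first exact: computable_exp2.
apply: computable_ext (computable_succ (computable_add hg hg)) => xs _.
by rewrite addnn.
Qed.

Lemma find_eqP (p : pred nat) m n : p n -> n < m ->
  (forall i, p i -> i = n) -> find p (iota 0 m) = n.
Proof.
move=> pn nm un.
have h : has p (iota 0 m) by apply/hasP; exists n => //; rewrite mem_iota.
have := nth_find 0 h; rewrite nth_iota ?add0n => [/un //|].
by rewrite -[X in _ < X](size_iota 0 m) -has_find.
Qed.

(** Both components of a pair are smaller than the pair, so unpairing is a bounded search. At 0 the
    range is empty and the search returns 0, the default head. *)
Lemma computable_nhead k f : computable k f -> computable k (fun xs => nhead (f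
  xs)).
Proof.
apply: computable_app1.
have h : decided 2 (fun xs => has (fun b =>
    npair (nth 0 xs 0) b == nth 0 xs 1) (iota 0 (nth 0 xs 1))).
  apply: (@decided_has 2 (fun xs => npair (nth 0 xs 1) (nth 0 xs 0)
    == nth 0 xs 2)); last exact: computable_arg.
  apply: decided_eq; last exact: computable_arg.
  by apply: computable_npair; apply: computable_arg.
apply: computable_ext (computable_find h (computable_arg 1 0)) => xs _ /=.
have [->//|n0] := posnP (nth 0 xs 0).
apply: find_eqP; last 1 first.
- move=> i /hasP[b _ /eqP]; rewrite [in X in _ = X](npair_split n0).
  by case/npair_inj.
- apply/hasP; exists (ntail (nth 0 xs 0)); last by rewrite -npair_split.
  by rewrite mem_iota /= [in X in _ < X](npair_split n0) ltn_npair_r.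
- by rewrite [in X in _ < X](npair_split n0) ltn_npair_l.
Qed.

Lemma computable_ntail k f : computable k f -> computable k (fun xs => ntail (f
  xs)).
Proof.
apply: computable_app1.
have h : decided 2 (fun xs =>
    npair (nhead (nth 0 xs 1)) (nth 0 xs 0) == nth 0 xs 1).
  apply: decided_eq; last exact: computable_arg.
  apply: computable_npair; last exact: computable_arg.
  exact/computable_nhead/computable_arg.
apply: computable_ext (computable_find h (computable_arg 1 0)) => xs _ /=.
have [->//|n0] := posnP (nth 0 xs 0).
apply: find_eqP; last 1 first.
- by move=> i /eqP; rewrite [in X in _ = X](npair_split n0) => /npair_inj[].
- by rewrite -npair_split.
- by rewrite [in X in _ < X](npair_split n0) ltn_npair_r.
Qed.

Definition ndrop (j n : nat) : nat := CodeSeq.code (drop j (CodeSeq.decode n)).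

Lemma computable_ndrop k f g :
  computable k f -> computable k g -> computable k (fun xs => ndrop (f xs) (g
    xs)).
Proof.
move=> hf hg; have hs : computable k.+2 (fun xs => ntail (nth 0 xs 1)).
  exact/computable_ntail/computable_arg.
apply: computable_ext (computable_rec hg hs hf) => xs _ /=.
elim: (f xs) => [|n /= ->]; first by rewrite /ndrop drop0 CodeSeq.decodeK.
by rewrite /ntail /ndrop CodeSeq.codeK -drop1 drop_drop.
Qed.

(** Lets the code of a list bound a search over its positions. *)
Lemma leq_size_code s : size s <= CodeSeq.code s.
Proof. by elim: s => //= a s IH; apply: leq_ltn_trans IH (ltn_npair_r _ _). Qed.

(** * Horn clauses over the natural numbers *)

(** There is neither order nor subtraction: a clause states an inequality as an equation with a
    slack variable, and takes an argument apart by a pattern in its conclusion. *)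
Inductive expr : Type :=
| X of nat
| K of nat
| Add of expr & expr
| Mul of expr & expr
| Pair of expr & expr.

Fixpoint eval (v : nat -> nat) (t : expr) : nat :=
  match t with
  | X i => v i
  | K c => c
  | Add s t => eval v s + eval v t
  | Mul s t => eval v s * eval v t
  | Pair s t => npair (eval v s) (eval v t)
  end.

Record clause := Clause {
  guards : seq (expr * expr);
  premises : seq (seq expr);
  conclusion : seq expr }.

Definition guards_hold (v : nat -> nat) (gs : seq (expr * expr)) : bool :=
  all (fun g => eval v g.1 == eval v g.2) gs.

Inductive derivable (P : seq clause) : seq nat -> Prop :=
| derivable_clause c v :
    List.In c P -> guards_hold v (guards c) ->
    (forall b, List.In b (premises c) -> derivable P (map (eval v) b)) ->
    derivable P (map (eval v) (conclusion c)).

(** * Recursive search for a derivation *)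

Section ProofSearch.
Variable P : seq clause.

(* A proof line is npair a v, with a the code of the atom it asserts and v the
   code of the valuation used; later lines justify earlier ones. *)
Definition line_val (l : nat) : nat -> nat := nth 0 (CodeSeq.decode (ntail l)).

Definition asserted (x : nat) (s : seq nat) : bool := x \in map nhead s.

Definition justifies (l : nat) (s : seq nat) (c : clause) : bool :=
  [&& nhead l == CodeSeq.code (map (eval (line_val l)) (conclusion c)),
      guards_hold (line_val l) (guards c)
    & all (fun b => asserted (CodeSeq.code (map (eval (line_val l)) b)) s)
        (premises c)].

Fixpoint valid_proof (s : seq nat) : bool :=
  if s is l :: s' then has (justifies l s') P && valid_proof s' else true.

Lemma valid_proof_sound s l :
  valid_proof s -> l \in s -> derivable P (CodeSeq.decode (nhead l)).
Proof.
elim: s l => //= l s IH l' /andP[hl /[dup] vs /IH {}IH].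
rewrite inE => /predU1P[->|/IH//].
have {hl} [c cP /and3P[/eqP -> gs bs]] : exists2 c, List.In c P & justifies l s c.
  elim: P hl => //= c Q IHQ /orP[h|/IHQ[c' ? ?]]; first by exists c => //; left.
  by exists c' => //; right.
rewrite CodeSeq.codeK; apply: derivable_clause => // b.
elim: (premises c) bs => //= b' bs' IHb /andP[/mapP[l2 /IH d E] /IHb{}IHb].
by case=> [<-|/IHb//]; rewrite -E CodeSeq.codeK in d.
Qed.

Lemma justifiesW l s s' c : {subset s <= s'} -> justifies l s c -> justifies l
  s' c.
Proof.
move=> ss /and3P[h1 h2 h3]; apply/and3P; split=> //; apply: sub_all h3 => b.
by move=> /mapP[x /ss xs' E]; apply/mapP; exists x.
Qed.

(** A line is justified by lines after it, so appending a proof can only add premises. *)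
Lemma valid_proof_cat s s' :
  valid_proof s -> valid_proof s' -> valid_proof (s ++ s').
Proof.
elim: s => //= l s IH /andP[hl /IH{}IH] /IH ->; rewrite andbT.
by apply: sub_has hl => c; apply: justifiesW => x; rewrite mem_cat => ->.
Qed.

(* A proof line stores only finitely many values of a valuation. *)
Fixpoint expr_bound (t : expr) : nat :=
  match t with
  | X i => i.+1
  | K _ => 0
  | Add s t | Mul s t | Pair s t => expr_bound s + expr_bound t
  end.

Lemma eval_bound v m t : expr_bound t <= m ->
  eval (nth 0 (mkseq v m)) t = eval v t.
Proof.
elim: t => //= [i im|s IHs t IHt h|s IHs t IHt h|s IHs t IHt h].
- by rewrite nth_mkseq.
- by rewrite IHs ?IHt //; lia.
- by rewrite IHs ?IHt //; lia.
- by rewrite IHs ?IHt //; lia.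
Qed.

Definition clause_bound (c : clause) : nat :=
  \sum_(g <- guards c) (expr_bound g.1 + expr_bound g.2)
  + \sum_(b <- premises c) \sum_(t <- b) expr_bound t
  + \sum_(t <- conclusion c) expr_bound t.

Lemma map_eval_bound v m b : \sum_(t <- b) expr_bound t <= m ->
  map (eval (nth 0 (mkseq v m))) b = map (eval v) b.
Proof.
elim: b => //= t b IH; rewrite big_cons => h.
by rewrite eval_bound ?IH //; lia.
Qed.

Lemma valid_proof_complete a : derivable P a ->
  exists2 s, valid_proof s & asserted (CodeSeq.code a) s.
Proof.
elim=> c v cP gs _ bs.
have {bs} [s vs bs] : exists2 s, valid_proof s &
    forall b, List.In b (premises c) -> asserted (CodeSeq.code (map (eval v)
      b)) s.
  elim: (premises c) bs => [_|b bs IH h]; first by exists [::].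
  have [s vs sP] : exists2 s, valid_proof s & forall b, List.In b bs ->
      asserted (CodeSeq.code (map (eval v) b)) s.
    by apply: IH => b' hb; apply: h; right.
  have [s' vs' s'P] := h b (or_introl erefl).
  exists (s ++ s'); first exact: valid_proof_cat.
  move: s'P; rewrite /asserted map_cat => s'P b' /= [<-|/sP].
    by rewrite mem_cat s'P orbT.
  by rewrite mem_cat /asserted => ->.
(* The proofs of the premises are concatenated, and one line is put in front whose valuation is cut
   off past every variable of the clause. *)
pose m := clause_bound c.
pose l := npair (CodeSeq.code (map (eval v) (conclusion c)))
            (CodeSeq.code (mkseq v m)).
exists (l :: s); last by rewrite /asserted /= nhead_cons inE eqxx.
rewrite /= vs andbT.
suff hc : justifies l s c.
  by elim: P cP => //= c' Q IH [->|/IH ->]; rewrite ?hc // orbT.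
have lv : line_val l = nth 0 (mkseq v m).
  by rewrite /line_val ntail_cons CodeSeq.codeK.
rewrite /justifies lv nhead_cons map_eval_bound ?eqxx /=; last first.
  by rewrite /m /clause_bound; lia.
apply/andP; split.
  have : \sum_(g <- guards c) (expr_bound g.1 + expr_bound g.2) <= m.
    by rewrite /m /clause_bound; lia.
  move: gs; rewrite /guards_hold; elim: (guards c) => //= g gs IH.
  move=> /andP[/eqP E /IH{}IH]; rewrite big_cons => h.
  by rewrite !eval_bound ?E ?eqxx ?IH //; lia.
have : \sum_(b <- premises c) \sum_(t <- b) expr_bound t <= m.
  by rewrite /m /clause_bound; lia.
elim: (premises c) bs => //= b bs IH h; rewrite big_cons => hm.
rewrite map_eval_bound ?h //=; [|by left|by lia].
by apply: IH => [b' hb|]; [apply: h; right|lia].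
Qed.

Lemma computable_eval k f t : computable k f ->
  computable k (fun xs => eval (nth 0 (CodeSeq.decode (f xs))) t).
Proof.
move=> hf; elim: t => [i|c|s IHs t IHt|s IHs t IHt|s IHs t IHt] /=.
- apply: computable_ext (computable_nhead (computable_ndrop
    (computable_const k i) hf)) => xs _.
  by rewrite /nhead /ndrop CodeSeq.codeK -nth0 nth_drop addn0.
- exact: computable_const.
- exact: computable_add.
- exact: computable_mul.
- exact: computable_npair.
Qed.

Lemma computable_code_eval k f b : computable k f ->
  computable k (fun xs =>
    CodeSeq.code (map (eval (nth 0 (CodeSeq.decode (f xs)))) b)).
Proof.
move=> hf; elim: b => [|t b IH] /=; first exact: computable_const.
by apply: (computable_npair (computable_eval t hf) IH).
Qed.

(** The range on the left is the code of the list, which may exceed its length; positions past the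
    end give an [ndrop] equal to 0 and are discarded by the first test. Both the entry and its
    remaining list are read from one suffix. *)
Lemma has_ndrop (s : seq nat) (p : nat -> seq nat -> bool) :
  has (fun j => (ndrop j (CodeSeq.code s) != 0)
        && p (nhead (ndrop j (CodeSeq.code s)))
             (CodeSeq.decode (ntail (ndrop j (CodeSeq.code s)))))
    (iota 0 (CodeSeq.code s))
  = has (fun j => p (nth 0 s j) (drop j.+1 s)) (iota 0 (size s)).
Proof.
have key j : j < size s ->
    ndrop j (CodeSeq.code s) = npair (nth 0 s j) (CodeSeq.code (drop j.+1 s)).
  by move=> js; rewrite /ndrop CodeSeq.codeK (drop_nth 0 js).
apply/hasP/hasP => -[j]; rewrite mem_iota /= add0n => jlt.
  have [js|js] := ltnP j (size s);
    last by rewrite /ndrop CodeSeq.codeK drop_oversize.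
  rewrite key // nhead_cons ntail_cons CodeSeq.codeK => /andP[_ pj].
  by exists j => //; rewrite mem_iota.
move=> pj; exists j; first by rewrite mem_iota /= (leq_trans jlt) ?leq_size_code.
by rewrite key // nhead_cons ntail_cons CodeSeq.codeK pj andbT -lt0n npair_gt0.
Qed.

Lemma decided_asserted k f g : computable k f -> computable k g ->
  decided k (fun xs => asserted (f xs) (CodeSeq.decode (g xs))).
Proof.
move=> hf hg; apply: (@computable_app2 k (fun x n =>
  asserted x (CodeSeq.decode n)) _ _ _ hf hg).
have h : decided 3 (fun xs => (ndrop (nth 0 xs 0) (nth 0 xs 2) != 0)
    && (nhead (nhead (ndrop (nth 0 xs 0) (nth 0 xs 2))) == nth 0 xs 1)).
  have hd : computable 3 (fun xs => ndrop (nth 0 xs 0) (nth 0 xs 2)).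
    by apply: computable_ndrop; apply: computable_arg.
  apply: decided_and.
    exact/decided_neg/(decided_eq hd)/computable_const.
  apply: decided_eq (computable_arg 3 1).
  exact/computable_nhead/computable_nhead.
apply: computable_ext (decided_has h (computable_arg 2 1)) => xs _ /=.
rewrite -[nth 0 xs 1]CodeSeq.decodeK CodeSeq.codeK.
rewrite (@has_ndrop _ (fun l _ => nhead l == nth 0 xs 0)).
set s := CodeSeq.decode _; congr nat_of_bool; rewrite /asserted.
apply/hasP/mapP => [[j]|[l /(nthP 0)[j js <-] ->]].
  by rewrite mem_iota /= => js /eqP <-; exists (nth 0 s j) => //; apply: mem_nth.
by exists j; rewrite ?mem_iota.
Qed.

(** Turns the recursion on the list into a bounded quantifier over its suffixes, which [decided_has]
    handles. *)
Lemma valid_proofE s : valid_proof s = ~~ has (fun j =>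
  ~~ has (justifies (nth 0 s j) (drop j.+1 s)) P) (iota 0 (size s)).
Proof.
elim: s => //= l s ->; rewrite drop0 negb_or negbK; congr (_ && ~~ _).
rewrite -[1]add1n iotaDl has_map; apply: eq_has => j /=; by [].
Qed.

Lemma decided_justifies k f g c : computable k f -> computable k g ->
  decided k (fun xs => justifies (f xs) (CodeSeq.decode (g xs)) c).
Proof.
move=> hf hg; have ht := computable_ntail hf; apply: decided_and.
  by apply: decided_eq; [apply: computable_nhead|apply: computable_code_eval ht].
apply: decided_and.
  rewrite /guards_hold; elim: (guards c) => [|gd gs IH] /=.
    exact: computable_const.
  apply: decided_and IH; apply: decided_eq; exact: computable_eval ht.
elim: (premises c) => [|b bs IH] /=; first exact: computable_const.
apply: decided_and IH; apply: decided_asserted hg.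
exact: computable_code_eval ht.
Qed.

Lemma decided_has_justifies k f g : computable k f -> computable k g ->
  decided k (fun xs => has (justifies (f xs) (CodeSeq.decode (g xs))) P).
Proof.
move=> hf hg; elim: P => [|c Q IH] /=; first exact: computable_const.
exact: decided_or (decided_justifies c hf hg) IH.
Qed.

Lemma decided_valid_proof k f : computable k f ->
  decided k (fun xs => valid_proof (CodeSeq.decode (f xs))).
Proof.
apply: (@computable_app1 k (fun n => valid_proof (CodeSeq.decode n))).
pose d xs := ndrop (nth 0 xs 0) (nth 0 xs 1).
have hd : computable 2 d by apply: computable_ndrop; apply: computable_arg.
have h : decided 2 (fun xs => (d xs != 0) && ~~ has (justifies (nhead (d xs))
    (CodeSeq.decode (ntail (d xs)))) P).
  apply: decided_and; first exact/decided_neg/(decided_eq hd)/computable_const.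
  apply/decided_neg/decided_has_justifies; first exact: computable_nhead.
  exact: computable_ntail.
apply: computable_ext (decided_neg (decided_has h (computable_arg 1 0))).
move=> xs _ /=; rewrite valid_proofE /d /=.
rewrite -{1 2 3 4}[nth 0 xs 0]CodeSeq.decodeK.
by rewrite (@has_ndrop _ (fun l s => ~~ has (justifies l s) P)).
Qed.

Theorem derivable_search (q : nat) : exists e, forall x y,
  (exists z, derivable P [:: q; x; y; z]) ->
  exists2 z, derivable P [:: q; x; y; z] & reval e [:: x; y] z.
Proof.
pose fst_atom n := nhead (nhead n).
(* The unknown fourth argument is copied from the atom found, so the comparison fixes [q], [x], [y]
   and the length but leaves the answer free. *)
pose goal n x y :=
  npair q (npair x (npair y (npair (nhead (ndrop 3 (fst_atom n))) 0))).
pose good n x y := (n != 0) &&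
  (valid_proof (CodeSeq.decode n) && (fst_atom n == goal n x y)).
have hf k : computable k (fun xs => fst_atom (nth 0 xs 0)).
  exact/computable_nhead/computable_nhead/computable_arg.
have hz k : computable k (fun xs => nhead (ndrop 3 (fst_atom (nth 0 xs 0)))).
  exact/computable_nhead/(computable_ndrop (computable_const k 3)).
have [e eP] : decided 3 (fun xs => ~~ good (nth 0 xs 0) (nth 0 xs 1) (nth 0 xs
  2)).
  apply/decided_neg/decided_and.
    exact/decided_neg/(decided_eq (computable_arg 3 0))/computable_const.
  apply: decided_and (decided_valid_proof (computable_arg 3 0)) _.
  apply: decided_eq (hf 3) _.
  apply: computable_npair; first exact: computable_const.
  apply: computable_npair; first exact: computable_arg.
  apply: computable_npair; first exact: computable_arg.
  exact: computable_npair (hz 3) (computable_const _ _).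
have [o oP] := hz 1.
exists (RComp o [:: RMu e]) => x y [z dz].
have /ex_minnP[n gn nmin] : exists n, good n x y.
  have [s vs /mapP[l ls lE]] := valid_proof_complete dz.
  (* The search inspects only the first line, so the lines before the wanted one are dropped; a
     suffix of a valid proof is valid. *)
  move: vs; case/splitPr: ls => s1 s2 vs.
  have {}vs : valid_proof (l :: s2) by elim: s1 vs => //= ? ? IH /andP[_ /IH].
  exists (CodeSeq.code (l :: s2)); rewrite /good CodeSeq.codeK vs code_cons.
  rewrite -lt0n npair_gt0 /goal /fst_atom nhead_cons -lE /ndrop CodeSeq.codeK.
  rewrite [drop _ _]/= [CodeSeq.code [:: z]]code_cons nhead_cons !andTb.
  exact: eqxx.
have /and3P[n0 vn /eqP fE] := gn.
exists (nhead (ndrop 3 (fst_atom n))).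
  have := @valid_proof_sound _ (nhead n) vn; rewrite -lt0n in n0.
  rewrite [X in CodeSeq.decode X](npair_split n0) decode_npair inE eqxx.
  move=> /(_ isT); rewrite -/(fst_atom n) [X in CodeSeq.decode X]fE.
  by rewrite /goal !decode_npair decode0.
apply: (@reval_comp _ _ _ [:: n]); last exact: oP.
constructor; last by constructor.
(* [RMu] looks for a zero, so [e] computes the negated test: it has value 1, the successor of 0, at
   every smaller number. *)
apply: (@reval_mu _ _ _ (fun=> 0)) => [m mn|].
  have := eP [:: m; x; y] erefl; rewrite /= -/(good m x y).
  by case: (boolP (good m x y)) => // /nmin; rewrite leqNgt mn.
by have := eP [:: n; x; y] erefl; rewrite /= gn.
Qed.

End ProofSearch.

Arguments npair : simpl never.
Arguments CodeSeq.decode : simpl never.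

(** * The proof system *)

(* Predicate symbols; [sems] gives their meanings. *)
Notation tNeq := 0.
Notation tUnpair := 1.
Notation tOnes := 2.
Notation tCount := 3.
Notation tNth := 4.
Notation tFirst := 5.
Notation tMove := 6.
Notation tTake := 7.
Notation tRun := 8.
Notation tBits := 9.
Notation tLowest := 10.
Notation tWord := 11.
Notation tNear := 12.
Notation tWords := 13.
Notation tOracle := 14.
Notation tBall := 15.
Notation tLe := 16.
Notation tLt := 17.
Notation tLook := 18.
Notation tEnc := 19.
Notation tEncs := 20.
Notation tMatrix := 21.
Notation tTrue := 22.
Notation tCover := 23.
Notation tAnswer := 24.

Definition elist : seq expr -> expr := foldr Pair (K 0).
(** Stands for the rational (p - n) / (q + 1): a difference supplies the sign, and the shift
    excludes a zero denominator. *)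
Definition enum3 (p n q : expr) : expr := elist [:: p; n; q].
Definition eS (t : expr) : expr := Add t (K 1).
(** The pair of i and 0 is 2 ^ i times 1, so pairing also provides exponentiation. *)
Definition epow2 (i : expr) : expr := Pair i (K 0).

(** Horn clauses have no negation; inequality is derived positively from a nonzero difference. *)
Definition c_neq_lt := Clause [::] [::] [:: K tNeq; X 0; Add (X 0) (eS (X 1))].
Definition c_neq_gt := Clause [::] [::] [:: K tNeq; Add (X 0) (eS (X 1)); X 0].

(** The clause for 0 reads a blank beyond the written part of a tape. *)
Definition c_unpair0 := Clause [::] [::] [:: K tUnpair; K 0; K 0; K 0].
Definition c_unpair1 := Clause [::] [::]
  [:: K tUnpair; Pair (X 0) (X 1); X 0; X 1].

Definition c_ones0 := Clause [::] [::] [:: K tOnes; K 0; K 0].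
Definition c_ones1 := Clause [::] [:: [:: K tOnes; X 0; X 1]]
  [:: K tOnes; eS (X 0); Pair (K 1) (X 1)].

Definition c_count0 := Clause [::] [::] [:: K tCount; K 0; X 0; X 0].
Definition c_count1 := Clause [::] [:: [:: K tCount; X 0; eS (X 1); X 2]]
  [:: K tCount; Pair (K 1) (X 0); X 1; X 2].
Definition c_count2 := Clause [::]
  [:: [:: K tNeq; X 3; K 1]; [:: K tCount; X 0; X 1; X 2]]
  [:: K tCount; Pair (X 3) (X 0); X 1; X 2].

(** The empty list has no clause: a query beyond the listed oracle words blocks the derivation
    instead of receiving a default answer. *)
Definition c_nth0 := Clause [::] [::] [:: K tNth; Pair (X 0) (X 1); K 0; X 0].
Definition c_nth1 := Clause [::] [:: [:: K tNth; X 1; X 2; X 3]]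
  [:: K tNth; Pair (X 0) (X 1); eS (X 2); X 3].

(* An instruction table, a key (state and scanned symbols) and the right-hand
   side of the first applicable instruction, or 0 if there is none. *)
Definition ekey (s h g : expr) : expr := Pair s (Pair h g).
Definition einstr (s h g o : expr) : expr := Pair s (Pair h (Pair g o)).
Definition c_first0 := Clause [::] [::] [:: K tFirst; K 0; X 0; K 0].
Definition c_first1 := Clause [::] [::]
  [:: K tFirst; Pair (einstr (X 0) (X 1) (X 2) (X 3)) (X 4);
      ekey (X 0) (X 1) (X 2); X 3].
Definition c_first2 := Clause [::]
  [:: [:: K tNeq; X 5; ekey (X 0) (X 1) (X 2)]; [:: K tFirst; X 4; X 5; X 6]]
  [:: K tFirst; Pair (einstr (X 0) (X 1) (X 2) (X 3)) (X 4); X 5; X 6].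

Definition c_moveL := Clause [::] [:: [:: K tUnpair; X 0; X 2; X 3]]
  [:: K tMove; K 0; X 0; X 1; X 3; Pair (X 2) (X 1)].
Definition c_moveN := Clause [::] [::] [:: K tMove; K 1; X 0; X 1; X 0; X 1].
Definition c_moveR := Clause [::] [:: [:: K tUnpair; X 1; X 2; X 3]]
  [:: K tMove; K 2; X 0; X 1; Pair (X 2) (X 0); X 3].

Definition c_take0 := Clause [::] [::] [:: K tTake; K 0; K 0].
Definition c_take1 := Clause [::] [::] [:: K tTake; Pair (K 0) (X 0); K 0].
Definition c_take2 := Clause [::] [:: [:: K tTake; X 0; X 1]]
  [:: K tTake; Pair (eS (X 2)) (X 0); Pair (eS (X 2)) (X 1)].

Section RunClauses.
Let W := X 0. Let M := X 1. Let s := X 2.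
Let wl := X 3. Let wr := X 4. Let ql := X 5. Let qr := X 6. Let w := X 7.
Let h := X 8. Let ht := X 9. Let g := X 10. Let gt := X 11.

(** [tRun] is a big-step semantics: from the given configuration, with the words of W as oracle, M
    halts with output w. Outside the query state, M halts exactly when [tFirst] yields 0, since the
    right-hand side of an instruction is coded by a nonempty list. *)
Definition c_halt := Clause [::]
  [:: [:: K tNeq; s; K 1]; [:: K tUnpair; wr; h; ht]; [:: K tUnpair; qr; g; gt];
      [:: K tFirst; M; ekey s h g; K 0]; [:: K tTake; wr; w]]
  [:: K tRun; W; M; s; wl; wr; ql; qr; w].

Definition c_step :=
  let o := X 12 in let ow := X 13 in let oq := X 14 in
  let mw := X 15 in let mq := X 16 in
  let wl' := X 17 in let wr' := X 18 in let ql' := X 19 in let qr' := X 20 in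
  Clause [::]
  [:: [:: K tNeq; s; K 1]; [:: K tUnpair; wr; h; ht]; [:: K tUnpair; qr; g; gt];
      [:: K tFirst; M; ekey s h g; elist [:: o; ow; oq; mw; mq]];
      [:: K tMove; mw; wl; Pair ow ht; wl'; wr'];
      [:: K tMove; mq; ql; Pair oq gt; ql'; qr'];
      [:: K tRun; W; M; o; wl'; wr'; ql'; qr'; w]]
  [:: K tRun; W; M; s; wl; wr; ql; qr; w].

Definition c_ask :=
  let a := X 12 in let i := X 13 in let x := X 14 in
  Clause [::]
  [:: [:: K tCount; ql; K 0; a]; [:: K tCount; qr; a; i]; [:: K tNth; W; i; x];
      [:: K tRun; W; M; K 2; wl; wr; K 0; x; w]]
  [:: K tRun; W; M; K 1; wl; wr; ql; qr; w].
End RunClauses.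

(** The digits are prepended to a given tail, which spares clauses for concatenation; [tWord] is
    built the same way. *)
Definition c_bits0 := Clause [::] [::] [:: K tBits; K 0; X 0; X 0].
Definition c_bits1 := Clause [::] [:: [:: K tBits; X 0; X 1; X 2]]
  [:: K tBits; eS (Mul (K 2) (X 0)); X 1; Pair (K 1) (X 2)].
Definition c_bits2 := Clause [::] [:: [:: K tBits; eS (X 0); X 1; X 2]]
  [:: K tBits; Mul (K 2) (eS (X 0)); X 1; Pair (K 2) (X 2)].

Definition c_lowest0 := Clause [::] [::] [:: K tLowest; X 0; K 0].
Definition c_lowest1 := Clause [::] [::] [:: K tLowest; eS (Mul (K 2) (X 0));
  X 1].

Definition c_word_pos :=
  let m := X 0 in let k := X 1 in let q := X 2 in let r := X 3 in
  let b := X 4 in let w := X 5 in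
  Clause [:: (eS q, epow2 k)]
  [:: [:: K tLowest; m; k]; [:: K tBits; k; Pair (K 4) r; b];
      [:: K tBits; m; Pair (K 4) b; w]]
  [:: K tWord; enum3 m (K 0) q; r; w].
Definition c_word_neg :=
  let m := X 0 in let k := X 1 in let q := X 2 in let r := X 3 in
  let b := X 4 in let w := X 5 in
  Clause [:: (eS q, epow2 k)]
  [:: [:: K tLowest; eS m; k]; [:: K tBits; k; Pair (K 4) r; b];
      [:: K tBits; eS m; Pair (K 4) b; w]]
  [:: K tWord; enum3 (K 0) (eS m) q; r; Pair (K 3) w].

Section NumberClauses.
Let p := X 0. Let n := X 1. Let q := X 2.
Let p' := X 3. Let n' := X 4. Let q' := X 5.
Let A := Add (Mul p (eS q')) (Mul n' (eS q)).
Let B := Add (Mul p' (eS q)) (Mul n (eS q')).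

(** A and B come from clearing denominators in the comparison of the two rationals and moving each
    negative part to the other side. In [c_near], E is the product of the denominators. *)
Definition c_le := Clause [:: (Add A (X 6), B)] [::]
  [:: K tLe; enum3 p n q; enum3 p' n' q'].
Definition c_lt := Clause [:: (Add A (eS (X 6)), B)] [::]
  [:: K tLt; enum3 p n q; enum3 p' n' q'].
Definition c_near := let i := X 6 in
  let E := Mul (eS q) (eS q') in
  Clause [:: (Add (Mul (epow2 i) A) (eS (X 7)), Add (Mul (epow2 i) B) E);
             (Add (Mul (epow2 i) B) (eS (X 8)), Add (Mul (epow2 i) A) E)] [::]
  [:: K tNear; enum3 p n q; enum3 p' n' q'; i].
Definition c_ball := let i := X 3 in let m := X 4 in
  let pi := Mul p (epow2 i) in let ni := Mul n (epow2 i) in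
  Clause [:: (eS m, Mul (eS q) (epow2 i))] [::]
  [:: K tBall; enum3 p n q; i;
      Pair (enum3 pi (Add ni (eS q)) m) (enum3 (Add pi (eS q)) ni m)].
End NumberClauses.

Definition c_words0 := Clause [::] [::] [:: K tWords; K 0; X 0; K 0].
(** Being within 2 ^- i of both endpoints c and d implies it for every point between them, so one
    word serves the whole interval. *)
Definition c_words1 :=
  let c := X 0 in let d := X 1 in let Js := X 2 in let i := X 3 in
  let w := X 4 in let q := X 5 in let w' := X 6 in
  Clause [::]
  [:: [:: K tNear; q; c; i]; [:: K tNear; q; d; i]; [:: K tWords; Js; i; w'];
      [:: K tWord; q; w'; w]]
  [:: K tWords; Pair (Pair c d) Js; i; w].

(** The list may stop anywhere; its length is guessed along with the run that consults it. *)
Definition c_oracle0 := Clause [::] [::] [:: K tOracle; X 0; X 1; K 0].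
Definition c_oracle1 := Clause [::]
  [:: [:: K tWords; X 0; X 1; X 2]; [:: K tOracle; X 0; eS (X 1); X 3]]
  [:: K tOracle; X 0; X 1; Pair (X 2) (X 3)].

(* A box is a list of bindings npair x J of variables to intervals; unbound
   variables are confined to [0, 0]. *)
Definition ezero : expr := enum3 (K 0) (K 0) (K 0).
Definition c_look0 := Clause [::] [::] [:: K tLook; K 0; X 0; Pair ezero ezero].
Definition c_look1 := Clause [::] [::]
  [:: K tLook; Pair (Pair (X 0) (X 1)) (X 2); X 0; X 1].
Definition c_look2 := Clause [::]
  [:: [:: K tNeq; X 0; X 1]; [:: K tLook; X 3; X 0; X 4]]
  [:: K tLook; Pair (Pair (X 1) (X 2)) (X 3); X 0; X 4].

Definition c_enc_var := Clause [::] [:: [:: K tLook; X 0; X 1; X 2]]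
  [:: K tEnc; X 0; elist [:: K 0; X 1]; X 2].
(** The precision i is free. The output word must be that of a dyadic q with nothing after it, and J
    is the ball of radius 2 ^- i around q. *)
Definition c_enc_app :=
  let B := X 0 in let M := X 1 in let ts := X 2 in let J := X 3 in
  let Js := X 4 in let W := X 5 in let i := X 6 in let r := X 7 in
  let w := X 8 in let q := X 9 in
  Clause [::]
  [:: [:: K tEncs; B; ts; Js]; [:: K tOracle; Js; K 0; W]; [:: K tOnes; i; r];
      [:: K tRun; W; M; K 0; K 0; r; K 0; K 0; w]; [:: K tWord; q; K 0; w];
      [:: K tBall; q; i; J]]
  [:: K tEnc; B; Pair (K 1) (Pair M ts); J].

Definition c_encs0 := Clause [::] [::] [:: K tEncs; X 0; K 0; K 0].
Definition c_encs1 := Clause [::]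
  [:: [:: K tEnc; X 0; X 1; X 2]; [:: K tEncs; X 0; X 3; X 4]]
  [:: K tEncs; X 0; Pair (X 1) (X 3); Pair (X 2) (X 4)].

(* Polarity 0 is for the truth of a formula, polarity 1 for the falsity of its
   strengthening; b is the code of the connective or quantifier. *)
Section TruthClauses.
Variables (pol b : nat).
Let dl := X 0. Let B := X 1.

(** Strict and weak atoms are treated alike: t > 0 gives both, and t < delta refutes both t > delta
    and t >= delta. *)
Definition c_atom := let t := X 2 in let c := X 3 in let d := X 4 in
  Clause [::]
  [:: [:: K tEnc; B; t; Pair c d];
      if pol is 0 then [:: K tLt; ezero; c] else [:: K tLt; d; dl]]
  [:: K tMatrix; K pol; dl; B; elist [:: K b; t]].
Definition c_both := Clause [::]
  [:: [:: K tMatrix; K pol; dl; B; X 2]; [:: K tMatrix; K pol; dl; B; X 3]]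
  [:: K tMatrix; K pol; dl; B; elist [:: K b; X 2; X 3]].
Definition c_left := Clause [::]
  [:: [:: K tMatrix; K pol; dl; B; X 2]]
  [:: K tMatrix; K pol; dl; B; elist [:: K b; X 2; X 3]].
Definition c_right := Clause [::]
  [:: [:: K tMatrix; K pol; dl; B; X 3]]
  [:: K tMatrix; K pol; dl; B; elist [:: K b; X 2; X 3]].

Definition c_matrix := Clause [::] [:: [:: K tMatrix; K pol; dl; B; X 2]]
  [:: K tTrue; K pol; dl; B; elist [:: K 0; X 2]].

Let x := X 2. Let u := X 3. Let v := X 4. Let p := X 5.
Let c := X 6. Let c' := X 7. Let d' := X 8. Let d := X 9.
Let lo := X 10. Let hi := X 11.

(** The nonempty intervals [u, v] and [lo, hi] meet exactly when u <= hi and lo <= v; the upper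
    bound c' of u and the lower bound d' of v guarantee this on the whole box. *)
Definition c_some := Clause [::]
  [:: [:: K tEnc; B; u; Pair c c']; [:: K tEnc; B; v; Pair d' d];
      [:: K tLe; lo; hi]; [:: K tLe; c'; hi]; [:: K tLe; lo; d'];
      [:: K tTrue; K pol; dl; Pair (Pair x (Pair lo hi)) B; p]]
  [:: K tTrue; K pol; dl; B; elist [:: K b; x; u; v; p]].
Definition c_every := Clause [::]
  [:: [:: K tEnc; B; u; Pair c c']; [:: K tEnc; B; v; Pair d' d];
      [:: K tLe; lo; c]; [:: K tLe; d; hi];
      [:: K tCover; K pol; dl; B; x; Pair lo hi; p]]
  [:: K tTrue; K pol; dl; B; elist [:: K b; x; u; v; p]].
Definition c_cover0 := Clause [::]
  [:: [:: K tTrue; K pol; dl; Pair (Pair x (X 3)) B; p]]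
  [:: K tCover; K pol; dl; B; x; X 3; p].
Definition c_cover1 := Clause [::]
  [:: [:: K tTrue; K pol; dl; Pair (Pair x (Pair c c')) B; p];
      [:: K tCover; K pol; dl; B; x; Pair c' d; p]]
  [:: K tCover; K pol; dl; B; x; Pair c d; p].
End TruthClauses.

(* The denominator of delta is at least 1, and [code_int] doubles both parts. *)
Definition edelta (a b : expr) : expr :=
  elist [:: Mul (K 2) a; Mul (K 2) (eS b)].
Definition c_answer1 := Clause [::] [:: [:: K tTrue; K 0; X 2; K 0; X 0]]
  [:: K tAnswer; X 0; X 1; K 1].
Definition c_answer0 := Clause [::]
  [:: [:: K tTrue; K 1; enum3 (X 1) (K 0) (X 2); K 0; X 0]]
  [:: K tAnswer; X 0; edelta (X 1) (X 2); K 0].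

Definition prog : seq clause := [::
  c_neq_lt; c_neq_gt; c_unpair0; c_unpair1; c_ones0; c_ones1;
  c_count0; c_count1; c_count2; c_nth0; c_nth1; c_first0; c_first1; c_first2;
  c_moveL; c_moveN; c_moveR; c_take0; c_take1; c_take2; c_halt; c_step; c_ask;
  c_bits0; c_bits1; c_bits2; c_lowest0; c_lowest1; c_word_pos; c_word_neg;
  c_le; c_lt; c_near; c_ball; c_words0; c_words1; c_oracle0; c_oracle1;
  c_look0; c_look1; c_look2; c_enc_var; c_enc_app; c_encs0; c_encs1;
  c_atom 0 0; c_atom 0 1; c_atom 1 0; c_atom 1 1; c_both 0 2; c_both 1 3;
  c_left 0 3; c_left 1 2; c_right 0 3; c_right 1 2; c_matrix 0; c_matrix 1;
  c_some 0 1; c_some 1 2; c_every 0 2; c_every 1 1;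
  c_cover0 0; c_cover0 1; c_cover1 0; c_cover1 1; c_answer1; c_answer0].

(** * Rational numbers and words coded by natural numbers *)

Definition num (n : nat) : rat :=
  let s := CodeSeq.decode n in
  (((nth 0 s 0)%:R - (nth 0 s 1)%:R) / (nth 0 s 2).+1%:R)%R.

Definition ncode3 (p n q : nat) : nat := npair p (npair n (npair q 0)).

Lemma num_code3 p n q : num (ncode3 p n q) = ((p%:R - n%:R) / q.+1%:R)%R.
Proof. by rewrite /num /ncode3 !decode_npair. Qed.

Lemma num_zero : num (ncode3 0 0 0) = 0%R.
Proof. by rewrite num_code3 subrr mul0r. Qed.

Lemma num_surj (q : rat) : exists p n k, num (ncode3 p n k) = q.
Proof.
have dE : (`|denq q|.-1.+1 = `|denq q|)%N by rewrite prednK // absz_gt0.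
have hd : ((`|denq q|.-1.+1)%:R = (denq q)%:~R :> rat)%R.
  by rewrite dE natr_absz gtr0_norm // denq_gt0.
rewrite -[q]divq_num_den; case nE: (numq q) => [p|m].
  by exists p, 0, `|denq q|.-1; rewrite num_code3 hd subr0 pmulrn.
exists 0, m.+1, `|denq q|.-1; by rewrite num_code3 hd sub0r NegzE rmorphN /=.
Qed.

(** * Order and distance of coded rationals *)

Section NumberOrder.
Local Open Scope ring_scope.
Variables p n q p' n' q' : nat.
Let A := (p * q'.+1 + n' * q.+1)%N.
Let B := (p' * q.+1 + n * q'.+1)%N.
Let a := num (ncode3 p n q).
Let b := num (ncode3 p' n' q').

Lemma num_diff : (a - b) * (q.+1 * q'.+1)%:R = A%:R - B%:R :> rat.
Proof.
rewrite /a /b !num_code3 /A /B !natrD !natrM.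
have h1 : (q.+1%:R : rat) != 0 by rewrite pnatr_eq0.
have h2 : (q'.+1%:R : rat) != 0 by rewrite pnatr_eq0.
move: (q.+1%:R : rat) (q'.+1%:R : rat) h1 h2 => x y h1 h2.
by field; rewrite h1 h2.
Qed.

Lemma num_le : (a <= b) = (A <= B)%N.
Proof.
have h : 0 < (q.+1 * q'.+1)%:R :> rat by rewrite ltr0n.
by rewrite -subr_le0 -(pmulr_lle0 _ h) num_diff subr_le0 ler_nat.
Qed.

Lemma num_lt : (a < b) = (A < B)%N.
Proof.
have h : 0 < (q.+1 * q'.+1)%:R :> rat by rewrite ltr0n.
by rewrite -subr_lt0 -(pmulr_llt0 _ h) num_diff subr_lt0 ltr_nat.
Qed.

Lemma num_near i : (`|a - b| < 2 ^- i) =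
  (2 ^ i * A < 2 ^ i * B + q.+1 * q'.+1)%N
  && (2 ^ i * B < 2 ^ i * A + q.+1 * q'.+1)%N.
Proof.
set E := (q.+1 * q'.+1)%N.
have hE : 0 < E%:R :> rat by rewrite ltr0n.
have hp : 0 < (2 ^ i)%:R :> rat by rewrite ltr0n expn_gt0.
have -> : (2 ^- i : rat) = (2 ^ i)%:R^-1 by rewrite natrX.
rewrite -!(ltr_nat rat) !natrD ![(2 ^ i * _)%:R]natrM -/E.
(* Brings the bound over a denominator that contains E, so that [num_diff] applies to the left
   side. *)
have -> : (2 ^ i)%:R^-1 = E%:R / ((2 ^ i)%:R * E%:R) :> rat.
  by field; rewrite !lt0r_neq0.
rewrite ltr_pdivlMr ?mulr_gt0 //.
rewrite -[X in `|_| * X]gtr0_norm ?mulr_gt0 // -normrM mulrCA num_diff.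
rewrite ltr_norml mulrBr; move: (_ * A%:R) (_ * B%:R) (E%:R : rat) => x y z.
by apply/andP/andP => -[? ?]; split; lra.
Qed.

End NumberOrder.

Lemma bits_rec_fuel k k' n : n <= k -> n <= k' -> bits_rec k n = bits_rec k' n.
Proof.
elim: k k' n => [|k IH] [|k'] [|n] //= h h'; congr cons.
by apply: IH; lia.
Qed.

Lemma bits_odd n : bits n.*2.+1 = 1 :: bits n.
Proof.
rewrite /bits /= odd_double /= uphalf_double; congr cons.
by apply: bits_rec_fuel; lia.
Qed.

Lemma bits_even n : bits n.+1.*2 = 2 :: bits n.+1.
Proof.
rewrite /bits doubleS; transitivity (2 :: bits_rec n.*2.+1 n.+1).
  by rewrite /= negbK odd_double half_double.
by congr cons; apply: bits_rec_fuel; lia.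
Qed.

(** * Words of dyadic rationals *)

Section DyadicWords.
Local Open Scope ring_scope.

Lemma dyadic_lowest (m : int) (k : nat) : k = 0%N \/ odd `|m|%N ->
  let q := m%:~R / 2 ^+ k : rat in numq q = m /\ denq q = (2 ^ k)%:Z.
Proof.
move=> mk q.
have co : coprime `|m| `|(2 ^ k)%:Z|.
  case: mk => [->|om]; first by rewrite expn0 coprimen1.
  by rewrite coprime_sym coprimeXl // coprime2n.
have qE : q = m%:~R / (2 ^ k)%:Z%:~R by rewrite /q -pmulrn natrX.
rewrite qE; split.
  by rewrite (coprimeq_num co) gtr0_sg ?mul1r // ltz_nat expn_gt0.
rewrite (coprimeq_den co); case: eqP => [[E]|_] //.
by have := expn_gt0 2 k; rewrite E.
Qed.

Lemma dyadic_word_pos (m k : nat) : k = 0%N \/ odd m ->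
  dyadic_word (m%:R / 2 ^+ k)
  = bits m ++ [:: 4%N] ++ bits k ++ [:: 4%N].
Proof.
move=> mk; have [nE dE] := @dyadic_lowest m k mk.
rewrite pmulrn /dyadic_word nE dE /= pfactorK //.
by rewrite ltNge divr_ge0 ?ler0z ?exprn_ge0.
Qed.

Lemma dyadic_word_neg (m k : nat) : k = 0%N \/ odd m.+1 ->
  dyadic_word (- m.+1%:R / 2 ^+ k)
  = 3%N :: bits m.+1 ++ [:: 4%N] ++ bits k ++ [:: 4%N].
Proof.
move=> mk; have [nE dE] : let q := (- m.+1%:Z)%:~R / 2 ^+ k : rat in
  numq q = - m.+1%:Z /\ denq q = (2 ^ k)%:Z by apply: dyadic_lowest.
have -> : - m.+1%:R = (- m.+1%:Z)%:~R :> rat by rewrite mulrNz -pmulrn.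
rewrite /dyadic_word nE dE abszN !absz_nat pfactorK //.
by rewrite pmulr_llt0 ?invr_gt0 ?exprn_gt0 // ltrz0 oppr_lt0.
Qed.

(** Halve an even numerator until it is odd or the exponent reaches 0. *)
Lemma dyadic_normal (q : rat) : dyadic q -> exists (m : int) (k : nat),
  (k = 0%N \/ odd `|m|%N) /\ q = m%:~R / 2 ^+ k.
Proof.
move=> [m [k ->]]; elim: k m => [|k IH] m.
  by exists m, 0%N; split => //; left.
case om: (odd `|m|%N); first by exists m, k.+1; split=> //; right.
have [m' mE] : exists m' : int, m = 2 * m'.
  exists (m %/ 2)%Z; rewrite mulrC divzK //; lia.
have [m2 [k2 [h E]]] := IH m'; exists m2, k2; split=> //; rewrite -E mE.
by rewrite rmorphM /= exprS -mulf_div divff ?mul1r.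
Qed.

Fixpoint bits_value (s : seq nat) : nat :=
  if s is b :: s' then ((bits_value s').*2 + (b == 1%N))%N else 0%N.

Lemma bits_value_cons b s :
  bits_value (b :: s) = ((bits_value s).*2 + (b == 1%N))%N.
Proof. by []. Qed.

Lemma bitsK : cancel bits bits_value.
Proof.
elim/ltn_ind => -[|n] // IH.
have [m [nE|nE]] : exists m, n = m.*2 \/ n = m.*2.+1.
- by exists n./2; have := odd_double_half n; case: (odd n) => /=; lia.
- by rewrite nE bits_odd bits_value_cons IH ?addn1 //; lia.
- by rewrite nE -doubleS bits_even bits_value_cons IH ?addn0 //; lia.
Qed.

Lemma bits_digit n : all (fun b => b \in [:: 1; 2]%N) (bits n).
Proof.
rewrite /bits; move: {1}n => k; elim: k n => //= k IH [|n] //=.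
by rewrite IH; case: odd.
Qed.

(** The separator 4 is not a digit, so its first occurrence marks where the digits end. *)
Lemma bits_cat_inj n n' s s' :
  bits n ++ 4%N :: s = bits n' ++ 4%N :: s' -> n = n' /\ s = s'.
Proof.
have ix m r : index 4%N (bits m ++ 4%N :: r) = size (bits m).
  rewrite index_cat; case: ifP => [h|_]; last by rewrite /= addn0.
  by have /allP/(_ _ h) := bits_digit m.
move=> E; have szE : size (bits n) = size (bits n') by rewrite -(ix n s) E ix.
move/eqP: E; rewrite eqseq_cat // => /andP[/eqP bE /eqP[->]]; split=> //.
by rewrite -[n]bitsK bE bitsK.
Qed.

Lemma dyadic_den (q : rat) : dyadic q -> denq q = (2 ^ logn 2 `|denq q|)%:Z.
Proof.
by move=> /dyadic_normal[m [k [mk ->]]]; have [_ ->] := dyadic_lowest mk;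
  rewrite /= pfactorK.
Qed.

(** The sign is visible in the first symbol, as 3 is neither a digit nor the separator. Dyadicity is
    essential: the word keeps only the exponent of 2 in the denominator. *)
Lemma dyadic_word_inj (q q' : rat) : dyadic q -> dyadic q' ->
  dyadic_word q = dyadic_word q' -> q = q'.
Proof.
move=> dq dq' E.
have key : bits `|numq q| ++ [:: 4%N] ++ bits (logn 2 `|denq q|) ++ [:: 4%N]
    = bits `|numq q'| ++ [:: 4%N] ++ bits (logn 2 `|denq q'|) ++ [:: 4%N] ->
    (q < 0) = (q' < 0) -> q = q'.
  move=> /bits_cat_inj[nE] /bits_cat_inj[lE _] sE.
  rewrite -[q]divq_num_den -[q']divq_num_den (dyadic_den dq) (dyadic_den dq') lE.
  congr (_%:~R / _); rewrite [numq q]intEsign [numq q']intEsign nE.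
  by rewrite !numq_lt0 sE.
have hd z s : head 0%N (bits z ++ 4%N :: s) != 3%N.
  have := bits_digit z; case: (bits z) => //= b t /andP[].
  by rewrite !inE => /orP[] /eqP ->.
move: E; rewrite /dyadic_word; case: (ltP q 0) (ltP q' 0) => h [] h' /=.
- by case=> E; apply: key => //; rewrite h h'.
- by move=> E; have := hd `|numq q'|%N (bits (logn 2 `|denq q'|) ++ [:: 4%N]);
  rewrite -E.
- by move=> E; have := hd `|numq q|%N (bits (logn 2 `|denq q|) ++ [:: 4%N]);
  rewrite E.
- by move=> E; apply: key => //; rewrite !ltNge h h'.
Qed.

Lemma dyadic_approx (R : realType) (x : R) i :
  exists q, dyadic q /\ `|ratr q - x| < 2 ^- i.
Proof.
exists ((Num.floor (x * 2 ^+ i))%:~R / 2 ^+ i); split.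
  by exists (Num.floor (x * 2 ^+ i)), i.
have p0 : 0 < 2 ^+ i :> R by rewrite exprn_gt0.
rewrite fmorph_div /= ratr_int rmorphXn /= ratr_nat.
have := floor_itv (x * 2 ^+ i); set f := (Num.floor _)%:~R.
rewrite intrD => /andP[h1 h2].
have -> : f / 2 ^+ i - x = (f - x * 2 ^+ i) / 2 ^+ i.
  by rewrite mulrBl mulfK ?lt0r_neq0.
rewrite normrM normfV [X in _ / X]gtr0_norm // -[X in _ < X]mul1r ltr_pM2r
  ?invr_gt0 //.
by rewrite ltr_norml; apply/andP; split; lra.
Qed.

End DyadicWords.

(** * Soundness *)

Fixpoint look (s : seq nat) (x : nat) : nat :=
  if s is y :: s' then if nhead y == x then ntail y else look s' x
  else npair (ncode3 0 0 0) (ncode3 0 0 0).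

Definition code_out (a : instr) : nat :=
  CodeSeq.code [:: o_state a; o_work a; o_query a;
                   code_move (o_mwork a); code_move (o_mquery a)].

Definition first_out (M : otm) (s h g : nat) : nat :=
  if [seq a <- M | [&& i_state a == s, i_work a == h & i_query a == g]] is a :: _
  then code_out a else 0.

Lemma run_det orc M k k' c c1 c2 :
  run orc M k c = Some c1 -> run orc M k' c = Some c2 -> c1 = c2.
Proof.
elim: k k' c => [|k IH] [|k'] c /=; case: (step orc M c) => [d|] //.
- by move=> [<-] [].
- by move=> [<-] [].
- by move=> [<-] [].
- exact: IH.
- by move=> [<-] [].
Qed.

Section Semantics.
Variables (R : realType) (F : language R).
Variable mach : forall n : nat, symb F n -> otm.

Notation D := CodeSeq.decode.

Definition itv (J : nat) (x : R) : bool :=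
  (ratr (num (nhead J)) <= x <= ratr (num (ntail J)))%R.

Definition in_box (B : nat) (e : env R) : Prop :=
  forall x, itv (look (D B) x) (e x).

Definition approx (i : nat) (qs : seq rat) (xs : seq R) : Prop :=
  all2 (fun q x => `|ratr q - x| < 2 ^- i)%R qs xs
  /\ (forall q, q \in qs -> dyadic q).

Definition dwords (qs : seq rat) : seq nat := flatten (map dyadic_word qs).

Definition verdict (pol : nat) (P Q : Prop) : Prop := if pol is 0 then P else ~ Q.

Definition bverdict (pol dl : nat) (e : env R) (b : bform F) : Prop :=
  verdict pol (holds e (to_formula b))
    (holds e (to_formula (strengthen (num dl) b))).

Definition meaningful_at (e : env R) (b : bform F) : Prop :=
  [/\ bform_wf b, terms_defined e b & proper_intervals e b].

Definition s_unpair r h t := h = nhead r /\ t = ntail r.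
Definition s_ones i r := D r = nseq i 1.
Definition s_count r a i := i = a + count_mem 1 (D r).
Definition s_nth W i w := i < size (D W) /\ w = nth 0 (D W) i.
Definition s_first T k o := forall M s h g,
  T = code_otm M -> k = npair s (npair h g) -> o = first_out M s h g.
Definition s_move m l r l' r' := forall mv,
  m = code_move mv -> (D l', D r') = tape_move mv (D l, D r).
Definition s_take r w := D w = take (index 0 (D r)) (D r).
(** The oracle is arbitrary beyond the words of W: the certified run asks only for listed values. *)
Definition s_run W T s wl wr ql qr w := forall M, T = code_otm M ->
  forall orc, (forall j, j < size (D W) -> orc j = D (nth 0 (D W) j)) ->
  exists k c, run orc M k (Config s (D wl, D wr) (D ql, D qr)) = Some c
    /\ output c = D w.
Definition s_bits n r w := D w = bits n ++ D r.
Definition s_lowest m k := k = 0 \/ odd m.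
Definition s_word q r w := dyadic (num q) /\ D w = dyadic_word (num q) ++ D r.
Definition s_near q c i : Prop := (`|num q - num c| < 2 ^- i)%R.
Definition s_words Js i w := forall xs, all2 itv (D Js) xs ->
  exists2 qs, approx i qs xs & D w = dwords qs.
Definition s_oracle Js i W := forall xs, all2 itv (D Js) xs ->
  forall j, j < size (D W) ->
  exists2 qs, approx (i + j) qs xs & D (nth 0 (D W) j) = dwords qs.
Definition s_ball q i J :=
  (num (nhead J) = num q - 2 ^- i /\ num (ntail J) = num q + 2 ^- i)%R.
(** Symbols may share a machine, so a code need not determine its term, and the claim is made for
    all terms with that code. Points where the term is undefined are exempt, because a box around a
    point of the domain may leave the domain. *)
Definition s_enc B c J := forall t, code_term mach t = c ->
  forall e, in_box B e -> tdef e t -> itv J (tval e t).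
Definition s_encs B cs Js := forall ts, map (code_term mach) ts = D cs ->
  forall e, in_box B e -> foldr (fun t P => tdef e t /\ P) True ts ->
  all2 itv (D Js) (map (tval e) ts).
Definition s_matrix pol dl B c := forall p, code_formula mach p = c -> qfree p ->
  forall e, in_box B e -> matrix_def e p ->
  verdict pol (holds e p) (holds e (strengthen_matrix (num dl) p)).
Definition s_true pol dl B c := forall b, code_bform mach b = c ->
  forall e, in_box B e -> meaningful_at e b -> bverdict pol dl e b.
(** The intervals of a cover may stick out of [u, v], where the body can be meaningless; hence
    meaningfulness is asked at the point [a] only. *)
Definition s_cover pol dl B x J c := forall b, code_bform mach b = c ->
  forall e a, in_box B e -> itv J a ->
  meaningful_at (upd e x a) b -> bverdict pol dl (upd e x a) b.
Definition s_answer c cd z := forall b d,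
  code_bform mach b = c -> code_rat d = cd -> (0 < d)%R -> bform_wf b ->
  meaningful b ->
  (z = 1 /\ bform_true b) \/ (z = 0 /\ ~ bform_true (strengthen d b)).

Definition sems : seq (seq nat -> Prop) :=
  let a := nth 0 in [::
  fun s => a s 0 <> a s 1;
  fun s => s_unpair (a s 0) (a s 1) (a s 2);
  fun s => s_ones (a s 0) (a s 1);
  fun s => s_count (a s 0) (a s 1) (a s 2);
  fun s => s_nth (a s 0) (a s 1) (a s 2);
  fun s => s_first (a s 0) (a s 1) (a s 2);
  fun s => s_move (a s 0) (a s 1) (a s 2) (a s 3) (a s 4);
  fun s => s_take (a s 0) (a s 1);
  fun s => s_run (a s 0) (a s 1) (a s 2) (a s 3) (a s 4) (a s 5) (a s 6) (a s 7);
  fun s => s_bits (a s 0) (a s 1) (a s 2);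
  fun s => s_lowest (a s 0) (a s 1);
  fun s => s_word (a s 0) (a s 1) (a s 2);
  fun s => s_near (a s 0) (a s 1) (a s 2);
  fun s => s_words (a s 0) (a s 1) (a s 2);
  fun s => s_oracle (a s 0) (a s 1) (a s 2);
  fun s => s_ball (a s 0) (a s 1) (a s 2);
  fun s => is_true (num (a s 0) <= num (a s 1))%R;
  fun s => is_true (num (a s 0) < num (a s 1))%R;
  fun s => look (D (a s 0)) (a s 1) = a s 2;
  fun s => s_enc (a s 0) (a s 1) (a s 2);
  fun s => s_encs (a s 0) (a s 1) (a s 2);
  fun s => s_matrix (a s 0) (a s 1) (a s 2) (a s 3);
  fun s => s_true (a s 0) (a s 1) (a s 2) (a s 3);
  fun s => s_cover (a s 0) (a s 1) (a s 2) (a s 3) (a s 4) (a s 5);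
  fun s => s_answer (a s 0) (a s 1) (a s 2)].

Definition sem (a : seq nat) : Prop :=
  nth (fun=> True) sems (head 0 a) (behead a).

Definition sound (c : clause) : Prop := forall v,
  guards_hold v (guards c) ->
  foldr (fun b P => sem (map (eval v) b) /\ P) True (premises c) ->
  sem (map (eval v) (conclusion c)).

Lemma sound_derivable P a :
  foldr (fun c Q => sound c /\ Q) True P -> derivable P a -> sem a.
Proof.
move=> sP; elim=> c v cP gs _ IH.
have sc : sound c by elim: P cP sP {IH} => //= c' Q IH [-> []|/IH{}IH [] _].
apply: sc gs _; elim: (premises c) IH => //= b bs IHb h; split.
  by apply: h; left.
by apply: IHb => b' hb; apply: h; right.
Qed.

(** * Soundness of the clauses for machines, numbers and enclosures *)

Lemma sound_neq_lt : sound c_neq_lt.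
Proof. by move=> v _; rewrite /sem /= => _; lia. Qed.

Lemma sound_neq_gt : sound c_neq_gt.
Proof. by move=> v _; rewrite /sem /= => _; lia. Qed.

Lemma sound_unpair0 : sound c_unpair0.
Proof. by []. Qed.

Lemma sound_unpair1 : sound c_unpair1.
Proof. by move=> v _; rewrite /sem /= => _; split;
  rewrite ?nhead_cons ?ntail_cons. Qed.

Lemma sound_ones0 : sound c_ones0.
Proof. by []. Qed.

Lemma sound_ones1 : sound c_ones1.
Proof. by move=> v _; rewrite /sem /= => -[h _];
  rewrite /s_ones decode_npair addn1 [D _]h. Qed.

Lemma sound_count0 : sound c_count0.
Proof. by move=> v _; rewrite /sem /= => _; rewrite /s_count decode0 addn0. Qed.

Lemma sound_count1 : sound c_count1.
Proof.
move=> v _; rewrite /sem /= => -[h _]; rewrite /s_count decode_npair /=.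
by move: h; rewrite /sem /= /s_count addnA.
Qed.

Lemma sound_count2 : sound c_count2.
Proof.
move=> v _; rewrite /sem /= => -[h [h' _]]; rewrite /s_count decode_npair /=.
by move: h h'; rewrite /sem /= /s_count => /eqP/negbTE ->.
Qed.

Lemma sound_nth0 : sound c_nth0.
Proof. by move=> v _; rewrite /sem /= => _; rewrite /s_nth decode_npair. Qed.

Lemma sound_nth1 : sound c_nth1.
Proof.
by move=> v _; rewrite /sem /= => -[[h1 h2] _];
  rewrite /s_nth decode_npair addn1 /= ltnS.
Qed.

Lemma code_otm_cons a M : code_otm (a :: M) =
  npair (npair (i_state a) (npair (i_work a) (npair (i_query a) (code_out a))))
        (code_otm M).
Proof. by []. Qed.

Lemma sound_first0 : sound c_first0.
Proof.
move=> v _; rewrite /sem /= => _ -[|a M] s h g; rewrite ?code_otm_cons // => E.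
by have := npair_gt0 (npair (i_state a) (npair (i_work a) (npair (i_query a)
  (code_out a)))) (code_otm M); rewrite -E.
Qed.

Lemma sound_first1 : sound c_first1.
Proof.
move=> v _; rewrite /sem /= => _ -[|a M] s h g E.
  by have := npair_gt0 (npair (v 0) (npair (v 1) (npair (v 2) (v 3)))) (v 4);
    rewrite E.
move: E; rewrite code_otm_cons => /npair_inj[/npair_inj[E1 /npair_inj[E2
  /npair_inj[E3 E4]]] _].
by move=> /npair_inj[<- /npair_inj[<- <-]];
  rewrite /first_out /= -E1 -E2 -E3 !eqxx.
Qed.

Lemma sound_first2 : sound c_first2.
Proof.
move=> v _; rewrite /sem /= => -[ne [h1 _]] -[|a M] s h g E.
  by have := npair_gt0 (npair (v 0) (npair (v 1) (npair (v 2) (v 3)))) (v 4);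
    rewrite E.
move: E; rewrite code_otm_cons => /npair_inj[/npair_inj[E1 /npair_inj[E2
  /npair_inj[E3 _]]] E5] kE.
rewrite /first_out /=; case: ifP => [/and3P[/eqP sE /eqP hE /eqP gE]|_].
  by case: ne => /=; rewrite kE E1 E2 E3 sE hE gE.
exact: h1.
Qed.

Lemma sound_moveL : sound c_moveL.
Proof.
by move=> v _; rewrite /sem /= => -[[h1 h2] _] -[] //= _;
  rewrite decode_npair h1 h2 /ntail CodeSeq.codeK.
Qed.

Lemma sound_moveN : sound c_moveN.
Proof. by move=> v _; rewrite /sem /= => _ -[]. Qed.

Lemma sound_moveR : sound c_moveR.
Proof.
by move=> v _; rewrite /sem /= => -[[h1 h2] _] -[] //= _;
  rewrite decode_npair h1 h2 /ntail CodeSeq.codeK.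
Qed.

Lemma sound_take0 : sound c_take0.
Proof. by []. Qed.

Lemma sound_take1 : sound c_take1.
Proof. by move=> v _; rewrite /sem /= => _; rewrite /s_take decode_npair /=. Qed.

Lemma sound_take2 : sound c_take2.
Proof.
by move=> v _; rewrite /sem /= => -[h _];
  rewrite /s_take !decode_npair addn1 /= [D (v 1)]h.
Qed.

Lemma sound_halt : sound c_halt.
Proof.
move=> v _; rewrite /sem /= => -[s1 [[hE _] [[gE _] [fE [wE _]]]]] M ME orc _.
exists 0, (Config (v 2) (D (v 3), D (v 4)) (D (v 5), D (v 6))); split;
  last by rewrite /output /= [D (v 7)]wE.
rewrite /= /step /= (_ : (v 2 == query_state) = false); last exact/eqP.
have := fE _ _ _ _ ME erefl; rewrite /first_out hE gE /=.
by rewrite /applicable /=; case: filter => // a s;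
  rewrite /code_out code_cons => E;
  have := npair_gt0 (o_state a) (CodeSeq.code [:: o_work a; o_query a;
                   code_move (o_mwork a); code_move (o_mquery a)]); rewrite -E.
Qed.

Lemma sound_step : sound c_step.
Proof.
move=> v _; rewrite /sem /= => -[s1 [[hE htE] [[gE gtE] [fE [mwE [mqE [rE
  _]]]]]]] M ME orc orcE.
have [k [c [kE cE]]] := rE M ME orc orcE.
exists k.+1, c; split=> //=; rewrite -{}kE /= /step /=.
rewrite (_ : (v 2 == query_state) = false); last exact/eqP.
have := fE _ _ _ _ ME erefl; rewrite /first_out hE gE /=.
rewrite /applicable /=; case: filter => [E|a s].
  by have := npair_gt0 (v 12) (npair (v 13) (npair (v 14) (npair (v 15) (npair
    (v 16) 0)))); rewrite E.
rewrite /code_out !code_cons.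
move=> /npair_inj[-> /npair_inj[owE /npair_inj[oqE /npair_inj[mw /npair_inj[mq
  _]]]]].
have /= := mwE _ mw; have /= := mqE _ mq; rewrite !decode_npair.
rewrite htE gtE owE oqE /ntail !CodeSeq.codeK /tape_write /=.
by move=> <- <-.
Qed.

Lemma sound_ask : sound c_ask.
Proof.
move=> v _; rewrite /sem /= => -[cl [cr [[iW xE] [rE _]]]] M ME orc orcE.
have [k [c [kE cE]]] := rE M ME orc orcE.
exists k.+1, c; split=> //=; rewrite -{}kE /= count_cat.
by move: cl cr; rewrite /sem /= /s_count add0n => -> <-;
  rewrite xE orcE // decode0.
Qed.

Lemma sound_bits0 : sound c_bits0.
Proof. by []. Qed.

Lemma sound_bits1 : sound c_bits1.
Proof.
move=> v _; rewrite /sem /= => -[h _]; rewrite /s_bits decode_npair addn1 mul2n.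
by rewrite bits_odd h.
Qed.

Lemma sound_bits2 : sound c_bits2.
Proof.
move=> v _; rewrite /sem /= => -[h _]; rewrite /s_bits decode_npair mul2n.
by move: h; rewrite /s_bits addn1 bits_even => ->.
Qed.

Lemma sound_lowest0 : sound c_lowest0.
Proof. by move=> v _; rewrite /sem /= => _; left. Qed.

Lemma sound_lowest1 : sound c_lowest1.
Proof. by move=> v _; rewrite /sem /= => _; right;
  rewrite addn1 mul2n /= odd_double. Qed.

Lemma npair0 i : npair i 0 = 2 ^ i.
Proof. by rewrite /npair muln1. Qed.

Lemma dyadic_divX (m : int) (k : nat) : dyadic (m%:~R / 2 ^+ k).
Proof. by exists m, k. Qed.

Lemma sound_word_pos : sound c_word_pos.
Proof.
move=> v gd; rewrite /guards_hold /= npair0 addn1 andbT in gd; move/eqP: gd => qE.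
rewrite /sem /= => -[mk [h1 [h2 _]]]; rewrite /s_word -/(ncode3 _ _ _) num_code3.
rewrite qE subr0 natrX; split; first by rewrite pmulrn; apply: dyadic_divX.
by rewrite dyadic_word_pos // h2 decode_npair h1 decode_npair -!catA.
Qed.

Lemma sound_word_neg : sound c_word_neg.
Proof.
move=> v gd; rewrite /guards_hold /= npair0 addn1 andbT in gd; move/eqP: gd => qE.
rewrite /sem /= !addn1 => -[mk [h1 [h2 _]]];
  rewrite /s_word -/(ncode3 _ _ _) num_code3.
rewrite qE sub0r natrX; split.
  by rewrite pmulrn -mulrNz; apply: dyadic_divX.
rewrite decode_npair dyadic_word_neg // h2 decode_npair h1 decode_npair.
by rewrite cat_cons -!catA.
Qed.

Lemma sound_le : sound c_le.
Proof.
move=> v; rewrite /guards_hold /= !addn1 andbT => /eqP h; rewrite /sem /= => _.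
by rewrite -!/(ncode3 _ _ _) num_le -h leq_addr.
Qed.

Lemma sound_lt : sound c_lt.
Proof.
move=> v; rewrite /guards_hold /= !addn1 andbT => /eqP h; rewrite /sem /= => _.
by rewrite -!/(ncode3 _ _ _) num_lt -h addnS ltnS leq_addr.
Qed.

Lemma sound_near : sound c_near.
Proof.
move=> v gd; rewrite /guards_hold /= npair0 !addn1 andbT in gd.
move: gd => /andP[/eqP h1 /eqP h2].
rewrite /sem /= => _; rewrite /s_near -!/(ncode3 _ _ _) num_near.
by rewrite -h1 -h2 !addnS !ltnS !leq_addr.
Qed.

Lemma sound_ball : sound c_ball.
Proof.
move=> v gd; rewrite /guards_hold /= npair0 !addn1 andbT in gd; move/eqP: gd => h.
rewrite /sem /= !addn1 => _; rewrite /s_ball nhead_cons ntail_cons.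
have E : ((v 4).+1%:R = (v 2).+1%:R * 2 ^+ v 3 :> rat)%R by rewrite h natrM natrX.
rewrite -!/(ncode3 _ _ _) !num_code3 {}E npair0 !natrD ![(_ * 2 ^ _)%:R%R]natrM
  natrX.
have h1 : ((v 2).+1%:R : rat)%R != 0%R by rewrite pnatr_eq0.
have h2 : (2 ^+ v 3 : rat)%R != 0%R by rewrite expf_neq0.
move: (_.+1%:R : rat)%R (2 ^+ v 3 : rat)%R h1 h2 => x y h1 h2.
by split; field; rewrite h1 h2.
Qed.

Lemma ratr_dist (a b : rat) i :
  (`|ratr a - ratr b : R| < 2 ^- i)%R = (`|a - b| < 2 ^- i)%R.
Proof.
rewrite -rmorphB -ratr_norm.
have -> : (2 ^- i : R)%R = ratr (2 ^- i)%R by rewrite fmorphV rmorphXn /=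
  ratr_nat.
by rewrite ltr_rat.
Qed.

Lemma sound_words0 : sound c_words0.
Proof.
move=> v _; rewrite /sem /= => _ [|x xs] //; rewrite decode0 //= => _.
by exists [::].
Qed.

Lemma sound_words1 : sound c_words1.
Proof.
move=> v _; rewrite /sem /= => -[nc [nd [ws [[dq wE] _]]]] [|x xs].
  by rewrite decode_npair.
rewrite decode_npair /= => /andP[xJ /ws[qs [aq dqs] wsE]].
exists (num (v 5) :: qs); last by rewrite wE wsE.
split=> [/=|q]; last by rewrite inE => /predU1P[->|/dqs].
rewrite aq andbT; move: xJ; rewrite /itv nhead_cons ntail_cons => /andP[h1 h2].
move: nc nd; rewrite /s_near -!ratr_dist !ltr_norml.
by move=> /andP[? ?] /andP[? ?]; apply/andP; split; lra.
Qed.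

Lemma sound_oracle0 : sound c_oracle0.
Proof. by move=> v _; rewrite /sem /= => _ xs _ j; rewrite decode0. Qed.

Lemma sound_oracle1 : sound c_oracle1.
Proof.
move=> v _; rewrite /sem /= => -[hw [ho _]] xs hx [|j]; rewrite decode_npair /=.
  by move=> _; have [qs ? ?] := hw xs hx; exists qs; rewrite ?addn0.
by rewrite ltnS => /(ho xs hx)[qs aq wE]; exists qs; rewrite // -addSnnS -addn1.
Qed.

Lemma sound_look0 : sound c_look0.
Proof. by []. Qed.

Lemma sound_look1 : sound c_look1.
Proof.
by move=> v _; rewrite /sem /= => _;
  rewrite decode_npair /= nhead_cons eqxx ntail_cons.
Qed.

Lemma sound_look2 : sound c_look2.
Proof.
move=> v _; rewrite /sem /= => -[ne [h _]]; rewrite decode_npair /= nhead_cons.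
by rewrite eq_sym (_ : (v 0 == v 1) = false) //; apply/eqP.
Qed.

Lemma code_term_var x : code_term mach (Var F x) = npair 0 (npair x 0).
Proof. by []. Qed.

Lemma code_term_app n (f : symb F n) ts : code_term mach (App f ts) =
  npair 1 (npair (code_otm (mach f))
    (CodeSeq.code [seq code_term mach (ts i) | i <- enum 'I_n])).
Proof. by []. Qed.

Lemma sound_enc_var : sound c_enc_var.
Proof.
move=> v _; rewrite /sem /= => -[h _] [x|n f ts].
  by rewrite code_term_var => /npair_inj[_ /npair_inj[-> _]] e /(_ (v 1));
    rewrite h.
by rewrite code_term_app => /npair_inj[].
Qed.

Lemma sound_encs0 : sound c_encs0.
Proof. by move=> v _; rewrite /sem /= => _ [|t ts]; rewrite decode0. Qed.

Lemma sound_encs1 : sound c_encs1.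
Proof.
move=> v _; rewrite /sem /= => -[h [hs _]] [|t ts]; rewrite !decode_npair //=.
move=> -[tE tsE] e eB [dt dts].
by rewrite (h t tE e eB dt) /= (hs ts tsE e eB dts).
Qed.

(** The words of W supply the first values of the name; the later ones are dyadic approximations of
    x itself, picked by choice. *)
Lemma oracle_name n (x : 'rV[R]_n) (Js W : nat) :
  all2 itv (D Js) [seq x ord0 i | i <- enum 'I_n] -> s_oracle Js 0 W ->
  exists2 g, is_name x g &
    forall j, j < size (D W) -> name_oracle g j = D (nth 0 (D W) j).
Proof.
move=> hx hW.
have ex j : exists y : 'rV[rat]_n,
    (forall i, dyadic (y ord0 i) /\ `|ratr (y ord0 i) - x ord0 i| < 2 ^- j)%R
    /\ (j < size (D W) ->
        flatten [seq dyadic_word (y ord0 i) | i <- enum 'I_n] = D (nth 0 (D W)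
          j)).
  have [jW|jW] := ltnP j (size (D W)); last first.
    have [y yP] := choice (fun i => dyadic_approx (x ord0 i) j).
    exists (\row_i y i)%R; split=> // i; rewrite !mxE; by case: (yP i).
  have [qs [aq dq] qE] := hW _ hx j jW.
  have sz : size qs = n.
    by move: aq; rewrite all2E size_map size_enum_ord => /andP[/eqP].
  exists (\row_i nth 0%R qs i)%R; split=> [i|_].
    rewrite !mxE; split; first by apply: dq; rewrite mem_nth // sz.
    move: aq; rewrite all2E => /andP[_ /allP /(_ (nth 0%R qs i, x ord0 i))].
    apply; apply/(nthP (0%R, 0%R)); exists i.
      by rewrite size_zip size_map size_enum_ord sz minnn.
    rewrite nth_zip ?(nth_map i) ?size_map -?enumT ?size_enum_ord //.
    by rewrite nth_ord_enum.
  rewrite qE /dwords; congr flatten.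
  transitivity (map dyadic_word [seq nth 0%R qs k | k <- map val (enum 'I_n)]).
    by rewrite -!map_comp; apply: eq_map => i /=; rewrite mxE.
  by rewrite val_enum_ord -[n in iota 0 n]sz -/(mkseq _ _) mkseq_nth.
have [g gP] := choice ex.
by exists g => [j i|j jW]; have [h1 h2] := gP j; [apply: h1|apply: h2].
Qed.

Hypothesis machP : forall (n : nat) (f : symb F n),
  type2_computes (mach f) (fdom f) (fval f).

Lemma sound_enc_app : sound c_enc_app.
Proof.
move=> v _; rewrite /sem /= => -[hts [hW [hr [hrun [[dq wE] [[lo hi] _]]]]]]
  [x|n f ts].
  by rewrite code_term_var => /npair_inj[].
rewrite code_term_app => /npair_inj[_ /npair_inj[ME tsE]] e eB /= [dts dom].
have enc : all2 itv (D (v 4)) [seq tval e (ts i) | i <- enum 'I_n].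
  have hc : map (code_term mach) [seq ts i | i <- enum 'I_n] = D (v 2).
    by rewrite -tsE CodeSeq.codeK -map_comp.
  have := hts _ hc e eB; rewrite -map_comp; apply.
  by elim: (enum 'I_n) => //= i s IH; split.
set x := (\row_i tval e (ts i))%R in dom *.
have xE : [seq tval e (ts i) | i <- enum 'I_n] = [seq x ord0 i | i <- enum 'I_n].
  by apply: eq_map => i; rewrite mxE.
(* The certificate does not show that its output is right. [machP] gives a correct halting run on
   the name g; determinism identifies it with the certified run, and injectivity of words identifies
   the two rationals. *)
rewrite xE in enc; have [g gx gW] := oracle_name enc hW.
have [q [dq' [k [c [kE cE]]] near]] := machP dom gx (v 6).
have [k' [c' [kE' cE']]] := hrun _ (esym ME) _ gW.
have cc : c' = c.
  by apply: run_det kE' _; move: kE; rewrite /start_config -[nseq _ _]hr; apply.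
have qE : q = num (v 9).
  apply: dyadic_word_inj => //.
  by rewrite -cE -cc cE' wE decode0 cats0.
rewrite /itv lo hi rmorphB rmorphD /= fmorphV rmorphXn /= ratr_nat -qE.
by move: near; rewrite ltr_norml => /andP[? ?]; apply/andP; split; lra.
Qed.

(** * Truth of bounded quantifiers and of strengthened atoms *)

Lemma tval_eq_in (e e' : env R) (t : term F) :
  (forall x, x \in tvars t -> e x = e' x) -> tval e t = tval e' t.
Proof.
elim: t => [x|n f ts IH] /= h; first by apply: h; rewrite inE.
congr (fval f); apply/rowP => i; rewrite !mxE; apply: IH => x xi; apply: h.
by apply/flattenP; exists (tvars (ts i)) => //; apply: map_f; rewrite mem_enum.
Qed.

Lemma tval_upd (e : env R) x a (t : term F) :
  x \notin tvars t -> tval (upd e x a) t = tval e t.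
Proof.
move=> xt; apply: tval_eq_in => y yt; rewrite /upd; case: eqP => // yx.
by rewrite -yx yt in xt.
Qed.

Lemma tval_const (e : env R) q : tval e (tconst F q) = ratr q.
Proof. by have [_] := sym_ratP F q (\row_i tval e (Var F 0))%R. Qed.

Lemma tval_neg (e : env R) (t : term F) : (tval e (tneg t) = - tval e t)%R.
Proof. by rewrite /= (proj2 (sym_negP F _)) mxE. Qed.

Lemma tval_add (e : env R) (s t : term F) :
  (tval e (tadd s t) = tval e s + tval e t)%R.
Proof. by rewrite /= (proj2 (sym_addP F _)) !mxE. Qed.

Lemma tval_sub (e : env R) (s t : term F) :
  (tval e (tsub s t) = tval e s - tval e t)%R.
Proof. by rewrite tval_add tval_neg. Qed.

Lemma holds_Le (e : env R) (s t : term F) :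
  holds e (Le s t) <-> (tval e s <= tval e t)%R.
Proof.
rewrite -[holds _ _]/(is_true (0 <= tval e (tsub t s))%R).
by rewrite tval_sub subr_ge0.
Qed.

Lemma holds_Neg_Le (e : env R) (s t : term F) :
  holds e (Neg (Le s t)) <-> (tval e t < tval e s)%R.
Proof.
rewrite -[holds _ _]/(is_true (0 < tval e (tneg (tsub t s)))%R).
by rewrite tval_neg tval_sub oppr_gt0 subr_lt0.
Qed.

Lemma tval_upd_var (e : env R) x a : tval (upd e x a) (Var F x) = a.
Proof. by rewrite /= /upd eqxx. Qed.

Lemma holds_BEx (e : env R) x u v (p : formula F) :
  x \notin tvars u -> x \notin tvars v ->
  holds e (BEx x u v p) <->
  exists2 a, (tval e u <= a <= tval e v)%R & holds (upd e x a) p.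
Proof.
move=> xu xv; split=> [[a [[/holds_Le + /holds_Le +] h]]|[a /andP[h1 h2] h]].
  by rewrite !tval_upd_var !tval_upd // => h1 h2; exists a; rewrite ?h1.
by exists a; split=> //; split; apply/holds_Le; rewrite tval_upd_var tval_upd.
Qed.

Lemma holds_BAll (e : env R) x u v (p : formula F) :
  x \notin tvars u -> x \notin tvars v ->
  holds e (BAll x u v p) <->
  forall a, (tval e u <= a <= tval e v)%R -> holds (upd e x a) p.
Proof.
move=> xu xv; split=> [h a /andP[h1 h2]|h a].
  case: (h a) => // -[] /holds_Neg_Le; rewrite tval_upd_var tval_upd // => lt.
    by have := le_lt_trans h1 lt; rewrite ltxx.
  by have := le_lt_trans h2 lt; rewrite ltxx.
have [/h|/negP] := boolP (tval e u <= a <= tval e v)%R; first by right.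
move/negP; rewrite negb_and -!ltNge => /orP[lt|lt]; left; [left|right];
  by apply/holds_Neg_Le; rewrite tval_upd_var tval_upd.
Qed.

Lemma holds_strengthen_gt (e : env R) d (t : term F) :
  holds e (strengthen_matrix d (Gt0 t)) <-> (ratr d < tval e t)%R.
Proof.
rewrite -[holds _ _]/(is_true (0 < tval e (tsub t (tconst F d)))%R).
by rewrite tval_sub tval_const subr_gt0.
Qed.

Lemma holds_strengthen_ge (e : env R) d (t : term F) :
  holds e (strengthen_matrix d (Ge0 t)) <-> (ratr d <= tval e t)%R.
Proof.
rewrite -[holds _ _]/(is_true (0 <= tval e (tsub t (tconst F d)))%R).
by rewrite tval_sub tval_const subr_ge0.
Qed.

Lemma in_box_upd B (e : env R) x J a :
  in_box B e -> itv J a -> in_box (npair (npair x J) B) (upd e x a).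
Proof.
move=> eB aJ y; rewrite decode_npair /= nhead_cons ntail_cons /upd eq_sym.
by case: eqP => // _; apply: eB.
Qed.

Lemma in_box0 : in_box 0 (fun=> 0%R).
Proof.
move=> x; rewrite decode0 /itv /= nhead_cons ntail_cons num_zero.
by rewrite rmorph0 lexx.
Qed.

Lemma code_formulaE (p : formula F) : code_formula mach p =
  match p with
  | Gt0 t => npair 0 (npair (code_term mach t) 0)
  | Ge0 t => npair 1 (npair (code_term mach t) 0)
  | And p q => npair 2 (npair (code_formula mach p) (npair (code_formula mach
    q) 0))
  | Or p q => npair 3 (npair (code_formula mach p) (npair (code_formula mach q)
    0))
  | Ex x p => npair 4 (npair x (npair (code_formula mach p) 0))
  | All x p => npair 5 (npair x (npair (code_formula mach p) 0))
  end.
Proof. by case: p. Qed.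

Lemma code_bformE (b : bform F) : code_bform mach b =
  match b with
  | Matrix p => npair 0 (npair (code_formula mach p) 0)
  | QEx x u v b => npair 1 (npair x (npair (code_term mach u)
      (npair (code_term mach v) (npair (code_bform mach b) 0))))
  | QAll x u v b => npair 2 (npair x (npair (code_term mach u)
      (npair (code_term mach v) (npair (code_bform mach b) 0))))
  end.
Proof. by case: b. Qed.

(** * Soundness of the clauses for truth *)

Lemma sound_atom_pos b : b < 2 -> sound (c_atom 0 b).
Proof.
move=> b2 v _; rewrite /sem /= => -[enc [lt _]] p;
  rewrite code_formulaE => pE qf e eB dp.
have key t : code_term mach t = v 2 -> tdef e t -> (0 < tval e t)%R.
  move=> tE dt; have := enc t tE e eB dt; rewrite /itv nhead_cons => /andP[h _].
  by apply: lt_le_trans h; rewrite ltr0q -[X in (X < _)%R]num_zero.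
case: p pE qf dp => [t|t|p q|p q|x p|x p] // /npair_inj[bE];
  rewrite -?bE // in b2.
- by move=> /npair_inj[tE _] _ dt; apply: key.
- by move=> /npair_inj[tE _] _ dt; apply/ltW/key.
Qed.

Lemma sound_atom_neg b : b < 2 -> sound (c_atom 1 b).
Proof.
move=> b2 v _; rewrite /sem /= => -[enc [lt _]] p;
  rewrite code_formulaE => pE qf e eB dp.
have key t : code_term mach t = v 2 -> tdef e t -> (tval e t < ratr (num (v
  0)))%R.
  move=> tE dt; have := enc t tE e eB dt; rewrite /itv ntail_cons => /andP[_ h].
  by apply: le_lt_trans h _; rewrite ltr_rat.
case: p pE qf dp => [t|t|p q|p q|x p|x p] // /npair_inj[bE];
  rewrite -?bE // in b2.
- by move=> /npair_inj[tE _] _ dt /holds_strengthen_gt /lt_trans/(_ (key _ tE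
  dt)); rewrite ltxx.
- by move=> /npair_inj[tE _] _ dt /holds_strengthen_ge /le_lt_trans/(_ (key _
  tE dt)); rewrite ltxx.
Qed.

Lemma sound_both_pos : sound (c_both 0 2).
Proof.
move=> v _; rewrite /sem /= => -[h1 [h2 _]] p; rewrite code_formulaE.
case: p => [t|t|p q|p q|x p|x p] // /npair_inj[] // _ /npair_inj[pE
  /npair_inj[qE _]].
move=> /andP[pf qf] e eB [dp dq]; split; first exact: h1.
exact: h2.
Qed.

Lemma sound_both_neg : sound (c_both 1 3).
Proof.
move=> v _; rewrite /sem /= => -[h1 [h2 _]] p; rewrite code_formulaE.
case: p => [t|t|p q|p q|x p|x p] // /npair_inj[] // _ /npair_inj[pE
  /npair_inj[qE _]].
move=> /andP[pf qf] e eB [dp dq] [] /=; [exact: h1|exact: h2].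
Qed.

Lemma sound_left_pos : sound (c_left 0 3).
Proof.
move=> v _; rewrite /sem /= => -[h1 _] p; rewrite code_formulaE.
case: p => [t|t|p q|p q|x p|x p] // /npair_inj[] // _ /npair_inj[pE
  /npair_inj[qE _]].
by move=> /andP[pf qf] e eB [dp dq]; left; apply: h1.
Qed.

Lemma sound_right_pos : sound (c_right 0 3).
Proof.
move=> v _; rewrite /sem /= => -[h1 _] p; rewrite code_formulaE.
case: p => [t|t|p q|p q|x p|x p] // /npair_inj[] // _ /npair_inj[pE
  /npair_inj[qE _]].
by move=> /andP[pf qf] e eB [dp dq]; right; apply: h1.
Qed.

Lemma sound_left_neg : sound (c_left 1 2).
Proof.
move=> v _; rewrite /sem /= => -[h1 _] p; rewrite code_formulaE.
case: p => [t|t|p q|p q|x p|x p] // /npair_inj[] // _ /npair_inj[pE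
  /npair_inj[qE _]].
by move=> /andP[pf qf] e eB [dp dq] [+ _]; apply: h1.
Qed.

Lemma sound_right_neg : sound (c_right 1 2).
Proof.
move=> v _; rewrite /sem /= => -[h1 _] p; rewrite code_formulaE.
case: p => [t|t|p q|p q|x p|x p] // /npair_inj[] // _ /npair_inj[pE
  /npair_inj[qE _]].
by move=> /andP[pf qf] e eB [dp dq] [_ +]; apply: h1.
Qed.

Lemma sound_matrix pol : sound (c_matrix pol).
Proof.
move=> v _; rewrite /sem /= => -[h1 _] b; rewrite code_bformE.
case: b => [p|x t t' b|x t t' b] /npair_inj[] // _ /npair_inj[pE _] e eB [wf td
  _].
exact: h1.
Qed.

Lemma bounds_notin x (u v : term F) (b : bform F) :
  {subset tvars u ++ tvars v <= [seq y <- fvars (to_formula b) | y != x]} ->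
  x \notin tvars u /\ x \notin tvars v.
Proof.
by move=> h; split; apply/negP => xt; have := h x;
  rewrite mem_cat xt ?orbT mem_filter eqxx;
  move=> /(_ isT).
Qed.

Lemma some_witness pol dl B cu cv c c' d' d lo hi x cb (e : env R) u v b :
  s_enc B cu (npair c c') -> s_enc B cv (npair d' d) ->
  (num lo <= num hi)%R -> (num c' <= num hi)%R -> (num lo <= num d')%R ->
  s_true pol dl (npair (npair x (npair lo hi)) B) cb ->
  code_term mach u = cu -> code_term mach v = cv -> code_bform mach b = cb ->
  in_box B e -> tdef e u -> tdef e v -> (tval e u <= tval e v)%R ->
  (forall a, (tval e u <= a <= tval e v)%R -> meaningful_at (upd e x a) b) ->
  exists2 a, (tval e u <= a <= tval e v)%R & bverdict pol dl (upd e x a) b.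
Proof.
move=> hu hv; rewrite -!(ler_rat R) => lh ch ld ht uE vE bE eB du dv uv mb.
have := hu u uE e eB du; have := hv v vE e eB dv.
rewrite /itv !nhead_cons !ntail_cons => /andP[h1 _] /andP[_ h2].
(* The left end of the intersection of [lo, hi] and [u, v]; the hypotheses say precisely that it
   lies in both. *)
pose a := Num.max (ratr (num lo)) (tval e u).
have au : (tval e u <= a <= tval e v)%R.
  by rewrite le_max lexx orbT ge_max uv andbT; apply: le_trans ld h1.
exists a => //; apply: ht (mb a au) => //; apply: in_box_upd => //.
rewrite /itv nhead_cons ntail_cons le_max lexx ge_max lh /=.
exact: le_trans h2 ch.
Qed.

Lemma sound_some_pos : sound (c_some 0 1).
Proof.
move=> v _; rewrite /sem /= => -[hu [hv [lh [ch [ld [ht _]]]]]] b;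
  rewrite code_bformE.
case: b => [p|x u w b|x u w b] /npair_inj[] // _.
move=> /npair_inj[xE /npair_inj[uE /npair_inj[wE /npair_inj[bE _]]]] e eB.
move=> [[/bounds_notin[xu xw] wf] [du dw td] [uw pr]].
apply/holds_BEx => //.
rewrite -xE in ht; apply: (some_witness hu hv lh ch ld ht uE wE bE) => //.
by move=> a ha; split; [exact: wf|exact: td|exact: pr].
Qed.

Lemma sound_some_neg : sound (c_some 1 2).
Proof.
move=> v _; rewrite /sem /= => -[hu [hv [lh [ch [ld [ht _]]]]]] b;
  rewrite code_bformE.
case: b => [p|x u w b|x u w b] /npair_inj[] // _.
move=> /npair_inj[xE /npair_inj[uE /npair_inj[wE /npair_inj[bE _]]]] e eB.
move=> [[/bounds_notin[xu xw] wf] [du dw td] [uw pr]].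
move=> /(proj1 (holds_BAll _ _ xu xw)) h.
rewrite -xE in ht; have [a ha|a /h hb] := some_witness hu hv lh ch ld ht uE wE
  bE eB du dw uw.
  by split; [exact: wf|exact: td|exact: pr].
by apply.
Qed.

Lemma every_value pol dl B cu cv c c' d' d lo hi x cb (e : env R) u v b a :
  s_enc B cu (npair c c') -> s_enc B cv (npair d' d) ->
  (num lo <= num c)%R -> (num d <= num hi)%R ->
  s_cover pol dl B x (npair lo hi) cb ->
  code_term mach u = cu -> code_term mach v = cv -> code_bform mach b = cb ->
  in_box B e -> tdef e u -> tdef e v -> (tval e u <= a <= tval e v)%R ->
  meaningful_at (upd e x a) b -> bverdict pol dl (upd e x a) b.
Proof.
move=> hu hv; rewrite -!(ler_rat R) => lc dh hc uE vE bE eB du dv /andP[ua av].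
apply: hc => //.
have := hu u uE e eB du; have := hv v vE e eB dv.
rewrite /itv !nhead_cons !ntail_cons => /andP[_ h1] /andP[h2 _].
by rewrite (le_trans lc (le_trans h2 ua)) (le_trans av (le_trans h1 dh)).
Qed.

Lemma sound_every_pos : sound (c_every 0 2).
Proof.
move=> v _; rewrite /sem /= => -[hu [hv [lc [dh [hc _]]]]] b; rewrite code_bformE.
case: b => [p|x u w b|x u w b] /npair_inj[] // _.
move=> /npair_inj[xE /npair_inj[uE /npair_inj[wE /npair_inj[bE _]]]] e eB.
move=> [[/bounds_notin[xu xw] wf] [du dw td] [uw pr]].
apply/holds_BAll => // a ha; rewrite -xE in hc.
by apply: (every_value hu hv lc dh hc uE wE bE eB du dw ha); split;
  [exact: wf|exact: td|exact: pr].
Qed.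

Lemma sound_every_neg : sound (c_every 1 1).
Proof.
move=> v _; rewrite /sem /= => -[hu [hv [lc [dh [hc _]]]]] b; rewrite code_bformE.
case: b => [p|x u w b|x u w b] /npair_inj[] // _.
move=> /npair_inj[xE /npair_inj[uE /npair_inj[wE /npair_inj[bE _]]]] e eB.
move=> [[/bounds_notin[xu xw] wf] [du dw td] [uw pr]].
move=> /(proj1 (holds_BEx _ _ xu xw))[a ha]; rewrite -xE in hc.
by apply: (every_value hu hv lc dh hc uE wE bE eB du dw ha); split;
  [exact: wf|exact: td|exact: pr].
Qed.

Lemma sound_cover0 pol : sound (c_cover0 pol).
Proof.
move=> v _; rewrite /sem /= => -[h _] b bE e a eB aJ.
exact/(h b bE)/in_box_upd.
Qed.

Lemma sound_cover1 pol : sound (c_cover1 pol).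
Proof.
move=> v _; rewrite /sem /= => -[h [h' _]] b bE e a eB.
rewrite /itv nhead_cons ntail_cons => /andP[ca ad].
have [ac|/ltW ca'] := leP a (ratr (num (v 7))).
  by apply: (h b bE); apply: in_box_upd => //;
    rewrite /itv nhead_cons ntail_cons ca.
by apply: (h' b bE) => //; rewrite /itv nhead_cons ntail_cons ca'.
Qed.

Lemma sound_answer1 : sound c_answer1.
Proof.
move=> v _; rewrite /sem /= => -[h _] b d bE _ _ wf [td pr]; left; split=> //.
exact: (h b bE _ in_box0).
Qed.

Lemma code_rat_pos d : (0 < d)%R -> exists m k : nat,
  code_rat d = npair (2 * m) (npair (2 * k.+1) 0) /\ d = num (ncode3 m 0 k).
Proof.
move=> d0.
case nE: (numq d) => [m|m]; last by have := numq_gt0 d; rewrite d0 nE.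
have := denq_gt0 d; case dE: (denq d) => [[|k]|k] // _.
exists m, k; split; first by rewrite /code_rat nE dE /code_int -!mul2n.
by rewrite num_code3 subr0 -[d]divq_num_den nE dE -!pmulrn.
Qed.

Lemma sound_answer0 : sound c_answer0.
Proof.
move=> v _; rewrite /sem /= => -[h _] b d bE dE d0 wf [td pr]; right; split=> //.
have [m [k [E ->]]] := code_rat_pos d0.
move: dE; rewrite E addn1 => /npair_inj[/eqP + /npair_inj[/eqP + _]].
rewrite !eqn_pmul2l // => /eqP -> /eqP[->].
exact: (h b bE _ in_box0).
Qed.

Lemma derivable_sem a : derivable prog a -> sem a.
Proof.
apply: sound_derivable; rewrite /prog.
split; first exact: sound_neq_lt. split; first exact: sound_neq_gt.
split; first exact: sound_unpair0. split; first exact: sound_unpair1.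
split; first exact: sound_ones0. split; first exact: sound_ones1.
split; first exact: sound_count0. split; first exact: sound_count1.
split; first exact: sound_count2. split; first exact: sound_nth0.
split; first exact: sound_nth1. split; first exact: sound_first0.
split; first exact: sound_first1. split; first exact: sound_first2.
split; first exact: sound_moveL. split; first exact: sound_moveN.
split; first exact: sound_moveR. split; first exact: sound_take0.
split; first exact: sound_take1. split; first exact: sound_take2.
split; first exact: sound_halt. split; first exact: sound_step.
split; first exact: sound_ask. split; first exact: sound_bits0.
split; first exact: sound_bits1. split; first exact: sound_bits2.
split; first exact: sound_lowest0. split; first exact: sound_lowest1.
split; first exact: sound_word_pos. split; first exact: sound_word_neg.
split; first exact: sound_le. split; first exact: sound_lt.
split; first exact: sound_near. split; first exact: sound_ball.
split; first exact: sound_words0. split; first exact: sound_words1.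
split; first exact: sound_oracle0. split; first exact: sound_oracle1.
split; first exact: sound_look0. split; first exact: sound_look1.
split; first exact: sound_look2. split; first exact: sound_enc_var.
split; first exact: sound_enc_app. split; first exact: sound_encs0.
split; first exact: sound_encs1. split; first exact: (@sound_atom_pos 0 isT).
split; first exact: (@sound_atom_pos 1 isT).
split; first exact: (@sound_atom_neg 0 isT).
split; first exact: (@sound_atom_neg 1 isT). split; first exact: sound_both_pos.
split; first exact: sound_both_neg. split; first exact: sound_left_pos.
split; first exact: sound_left_neg. split; first exact: sound_right_pos.
split; first exact: sound_right_neg. split; first exact: sound_matrix.
split; first exact: sound_matrix. split; first exact: sound_some_pos.
split; first exact: sound_some_neg. split; first exact: sound_every_pos.
split; first exact: sound_every_neg. split; first exact: sound_cover0.
split; first exact: sound_cover0. split; first exact: sound_cover1.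
split; first exact: sound_cover1. split; first exact: sound_answer1.
split; first exact: sound_answer0.
exact: I.
Qed.

End Semantics.

(** * Completeness *)

Notation dv := (derivable prog).

(** The valuation is given as a list, whose entry i is the value of [X i]. *)
Lemma infer c v a :
  List.In c prog -> guards_hold (nth 0 v) (guards c) ->
  foldr (fun b P => dv (map (eval (nth 0 v)) b) /\ P) True (premises c) ->
  map (eval (nth 0 v)) (conclusion c) = a -> dv a.
Proof.
move=> cP gs bs <-; apply: derivable_clause => //.
by elim: (premises c) bs => //= b bs IH [hb /IH{}IH] b' [<-|/IH].
Qed.

Ltac in_prog := rewrite /prog; repeat (first [by left | right]).
Ltac use c v := apply: (@infer c v);
  [by in_prog | rewrite /guards_hold /= | rewrite /= | rewrite /=].

Lemma dv_neq a b : a <> b -> dv [:: tNeq; a; b].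
Proof.
move=> ab; have [lt|le] := ltnP a b.
  by use c_neq_lt [:: a; b - a.+1] => //; congr [:: _; _; _]; lia.
by use c_neq_gt [:: b; a - b.+1] => //; congr [:: _; _; _]; lia.
Qed.

Lemma dv_unpair s :
  dv [:: tUnpair; CodeSeq.code s; head 0 s; CodeSeq.code (behead s)].
Proof.
case: s => [|x s]; first by use c_unpair0 (Nil nat).
by use c_unpair1 [:: x; CodeSeq.code s].
Qed.

Lemma dv_ones i : dv [:: tOnes; i; CodeSeq.code (nseq i 1)].
Proof.
elim: i => [|i IH]; first by use c_ones0 (Nil nat).
by use c_ones1 [:: i; CodeSeq.code (nseq i 1)] => //; rewrite addn1.
Qed.

Lemma dv_count s a : dv [:: tCount; CodeSeq.code s; a; a + count_mem 1 s].
Proof.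
elim: s a => [|x s IH] a; first by use c_count0 [:: a] => //; rewrite addn0.
have [->|x1] := eqVneq x 1.
  use c_count1 [:: CodeSeq.code s; a; a + (count_mem 1 s).+1] => //.
  by split=> //; have := IH (a + 1); rewrite -addnA add1n.
use c_count2 [:: CodeSeq.code s; a; a + count_mem 1 s; x] => //.
  by split; [apply/dv_neq/eqP|split].
by rewrite (negbTE x1).
Qed.

Lemma dv_nth s i : i < size s -> dv [:: tNth; CodeSeq.code s; i; nth 0 s i].
Proof.
elim: s i => // x s IH [|i] /= h; first by use c_nth0 [:: x; CodeSeq.code s].
use c_nth1 [:: x; CodeSeq.code s; i; nth 0 s i] => //; last by rewrite addn1.
by split=> //; apply: IH.
Qed.

Lemma dv_first M s h g :
  dv [:: tFirst; code_otm M; npair s (npair h g); first_out M s h g].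
Proof.
elim: M => [|a M IH]; first by use c_first0 [:: npair s (npair h g)].
pose v := [:: i_state a; i_work a; i_query a; code_out a; code_otm M;
              npair s (npair h g); first_out M s h g].
rewrite /first_out /=; case: ifP => [/and3P[/eqP <- /eqP <- /eqP <-]|ne].
  by use c_first1 v.
use c_first2 v => //; split=> //; apply: dv_neq.
move=> /npair_inj[sE /npair_inj[hE gE]].
by rewrite sE hE gE !eqxx in ne.
Qed.

Lemma dv_move mv l r : let t := tape_move mv (l, r) in
  dv [:: tMove; code_move mv; CodeSeq.code l; CodeSeq.code r;
         CodeSeq.code t.1; CodeSeq.code t.2].
Proof.
case: mv => /=.
- use c_moveL [:: CodeSeq.code l; CodeSeq.code r; head 0 l;
  CodeSeq.code (behead l)] => //.
  by split=> //; apply: dv_unpair.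
- by use c_moveN [:: CodeSeq.code l; CodeSeq.code r].
- use c_moveR [:: CodeSeq.code l; CodeSeq.code r; head 0 r;
  CodeSeq.code (behead r)] => //.
  by split=> //; apply: dv_unpair.
Qed.

Lemma dv_take s : dv [:: tTake; CodeSeq.code s;
  CodeSeq.code (take (index 0 s) s)].
Proof.
elim: s => [|[|x] s IH]; first by use c_take0 (Nil nat).
  by use c_take1 [:: CodeSeq.code s].
by use c_take2 [:: CodeSeq.code s; CodeSeq.code (take (index 0 s) s); x] => //;
  rewrite !addn1.
Qed.

(** A halting run makes finitely many queries, so some prefix of the oracle determines it. Longer
    lists are allowed, which lets one bound serve all steps of the run. *)
Lemma dv_run orc M k c c' : run orc M k c = Some c' ->
  exists N, forall W, N <= size W ->
  (forall j, j < N -> nth 0 W j = CodeSeq.code (orc j)) ->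
  dv [:: tRun; CodeSeq.code W; code_otm M; c_state c;
         CodeSeq.code (c_work c).1; CodeSeq.code (c_work c).2;
         CodeSeq.code (c_query c).1; CodeSeq.code (c_query c).2;
         CodeSeq.code (output c')].
Proof.
have halt d : step orc M d = None -> exists N, forall W, N <= size W ->
    (forall j, j < N -> nth 0 W j = CodeSeq.code (orc j)) ->
    dv [:: tRun; CodeSeq.code W; code_otm M; c_state d;
           CodeSeq.code (c_work d).1; CodeSeq.code (c_work d).2;
           CodeSeq.code (c_query d).1; CodeSeq.code (c_query d).2;
           CodeSeq.code (output d)].
  case: d => s [wl wr] [ql qr]; rewrite /step /=; case: eqP => // s1 nE.
  exists 0 => W _ _.
  use c_halt [:: CodeSeq.code W; code_otm M; s; CodeSeq.code wl; CodeSeq.code wr;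
    CodeSeq.code ql; CodeSeq.code qr;
    CodeSeq.code (output (Config s (wl, wr) (ql, qr)));
    head 0 wr; CodeSeq.code (behead wr); head 0 qr;
      CodeSeq.code (behead qr)] => //.
  split; first exact: dv_neq.
  split; first exact: dv_unpair.
  split; first exact: dv_unpair.
  split; last by split=> //; apply: dv_take.
  have := dv_first M s (head 0 wr) (head 0 qr); rewrite /first_out.
  by move: nE; rewrite /applicable /=; case: filter.
elim: k c => [|k IH] c /=; case sE: (step orc M c) => [d|] //.
- by move=> [<-]; apply: halt.
- move=> /IH[N hN]; move: sE; case: c => s [wl wr] [ql qr]; rewrite /step /=.
  case: eqP => [-> [dE]|s1].
    (* Reading the answer at index i takes a list of at least i + 1 words. *)
    set i := count_mem _ _ in dE; exists (maxn N i.+1) => W; rewrite geq_max.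
    move=> /andP[NW iW] WE; have {hN} := hN W NW.
    rewrite -dE /= => hN.
    use c_ask [:: CodeSeq.code W; code_otm M; query_state; CodeSeq.code wl;
      CodeSeq.code wr; CodeSeq.code ql; CodeSeq.code qr; CodeSeq.code (output c');
      0; 0; 0; 0; count_mem 1 ql; i; CodeSeq.code (orc i)] => //.
    split; first exact: (dv_count ql 0).
    split; first by have := dv_count qr (count_mem 1 ql); rewrite -count_cat.
    split; first by rewrite -WE ?leq_maxr //; apply: dv_nth.
    split=> //; apply: hN => j jN; apply: WE.
    by rewrite (leq_trans jN) ?leq_maxl.
  have := dv_first M s (head 0 wr) (head 0 qr); rewrite /first_out.
  rewrite /applicable /=; case: filter => // a _ hf [dE].
  exists N => W NW WE; have := hN W NW WE; rewrite -dE /= => hr.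
  set tw := tape_move _ _ in hr; set tq := tape_move _ _ in hr.
  use c_step [:: CodeSeq.code W; code_otm M; s; CodeSeq.code wl;
      CodeSeq.code wr; CodeSeq.code ql; CodeSeq.code qr; CodeSeq.code (output c');
      head 0 wr; CodeSeq.code (behead wr); head 0 qr; CodeSeq.code (behead qr);
      o_state a; o_work a; o_query a; code_move (o_mwork a);
        code_move (o_mquery a);
      CodeSeq.code tw.1; CodeSeq.code tw.2; CodeSeq.code tq.1;
        CodeSeq.code tq.2] => //.
  split; first exact: dv_neq.
  split; first exact: dv_unpair.
  split; first exact: dv_unpair.
  split; first exact: hf.
  split; first exact: (dv_move (o_mwork a) wl (o_work a :: behead wr)).
  split; first exact: (dv_move (o_mquery a) ql (o_query a :: behead qr)).
  by split.
- by move=> [<-]; apply: halt.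
Qed.

Lemma dv_bits n r : dv [:: tBits; n; CodeSeq.code r; CodeSeq.code (bits n ++ r)].
Proof.
elim/ltn_ind: n => -[|n] IH; first by use c_bits0 [:: CodeSeq.code r].
have [m [nE|nE]] : exists m, n = m.*2 \/ n = m.*2.+1.
- by exists n./2; have := odd_double_half n; case: (odd n) => /=; lia.
- rewrite nE bits_odd.
  use c_bits1 [:: m; CodeSeq.code r; CodeSeq.code (bits m ++ r)] => //.
    by split=> //; apply: IH; lia.
  by rewrite addn1 mul2n.
- rewrite nE -doubleS bits_even.
  use c_bits2 [:: m; CodeSeq.code r; CodeSeq.code (bits m.+1 ++ r)] => //.
    by split=> //; rewrite addn1; apply: IH; lia.
  by rewrite addn1 mul2n.
Qed.

Lemma dv_lowest m k : k = 0 \/ odd m -> dv [:: tLowest; m; k].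
Proof.
move=> [->|om]; first by use c_lowest0 [:: m].
use c_lowest1 [:: m./2; k] => //; congr [:: _; _; _].
by rewrite mul2n addn1; have := odd_double_half m; rewrite om.
Qed.

(** [num] gives a value to every natural number, but the arithmetic clauses match only triples of
    this shape. *)
Definition number (n : nat) : Prop := exists p m q, n = ncode3 p m q.

Lemma number_zero : number (ncode3 0 0 0).
Proof. by exists 0, 0, 0. Qed.

Lemma dv_word q : dyadic q -> exists n, [/\ number n, num n = q &
  forall r, dv [:: tWord; n; CodeSeq.code r; CodeSeq.code (dyadic_word q ++ r)]].
Proof.
move=> /dyadic_normal[m [k [mk ->]]].
have kE : (2 ^ k).-1.+1 = 2 ^ k by rewrite prednK ?expn_gt0.
case: m mk => [m|m] mk.
  exists (ncode3 m 0 (2 ^ k).-1); split; first by do 3!eexists.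
    by rewrite num_code3 kE subr0 natrX pmulrn.
  move=> r; rewrite -pmulrn dyadic_word_pos // -!catA.
  use c_word_pos [:: m; k; (2 ^ k).-1; CodeSeq.code r;
    CodeSeq.code (bits k ++ 4 :: r);
      CodeSeq.code (bits m ++ 4 :: bits k ++ 4 :: r)] => //.
    by rewrite npair0 addn1 kE eqxx.
  split; first exact: dv_lowest.
  split; first exact: (dv_bits k (4 :: r)).
  by split=> //; exact: (dv_bits m (4 :: bits k ++ 4 :: r)).
exists (ncode3 0 m.+1 (2 ^ k).-1); split; first by do 3!eexists.
  by rewrite num_code3 kE sub0r natrX NegzE mulrNz -pmulrn.
move=> r; rewrite NegzE mulrNz -pmulrn dyadic_word_neg // cat_cons -!catA.
use c_word_neg [:: m; k; (2 ^ k).-1; CodeSeq.code r;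
    CodeSeq.code (bits k ++ 4 :: r);
      CodeSeq.code (bits m.+1 ++ 4 :: bits k ++ 4 :: r)].
- by rewrite npair0 addn1 kE eqxx.
- rewrite addn1; split; first exact: dv_lowest.
  split; first exact: (dv_bits k (4 :: r)).
  by split=> //; exact: (dv_bits m.+1 (4 :: bits k ++ 4 :: r)).
- by rewrite addn1.
Qed.

Lemma dv_le a b : number a -> number b -> (num a <= num b)%R -> dv [:: tLe; a; b].
Proof.
move=> [p [n [q ->]]] [p' [n' [q' ->]]]; rewrite num_le => h.
use c_le [:: p; n; q; p'; n'; q';
  p' * q.+1 + n * q'.+1 - (p * q'.+1 + n' * q.+1)] => //.
by rewrite !addn1 subnKC ?eqxx.
Qed.

Lemma dv_lt a b : number a -> number b -> (num a < num b)%R -> dv [:: tLt; a; b].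
Proof.
move=> [p [n [q ->]]] [p' [n' [q' ->]]]; rewrite num_lt => h.
use c_lt [:: p; n; q; p'; n'; q';
  p' * q.+1 + n * q'.+1 - (p * q'.+1 + n' * q.+1).+1] => //.
by rewrite !addn1 addnS -addSn subnKC ?eqxx.
Qed.

Lemma dv_near a b i : number a -> number b -> (`|num a - num b| < 2 ^- i)%R ->
  dv [:: tNear; a; b; i].
Proof.
move=> [p [n [q ->]]] [p' [n' [q' ->]]]; rewrite num_near.
set A := p * _ + _; set B := p' * _ + _; set E := q.+1 * _ => /andP[h1 h2].
use c_near [:: p; n; q; p'; n'; q'; i;
  2 ^ i * B + E - (2 ^ i * A).+1; 2 ^ i * A + E - (2 ^ i * B).+1] => //.
have aux x y : x < y -> x + (y - x.+1).+1 = y by lia.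
by rewrite npair0 !addn1 -/A -/B -/E !aux ?eqxx.
Qed.

Lemma dv_ball a i : number a -> exists c d,
  [/\ number c, number d, num c = (num a - 2 ^- i)%R, num d = (num a + 2 ^- i)%R
    & dv [:: tBall; a; i; npair c d]].
Proof.
move=> [p [n [q ->]]].
have mE : (q.+1 * 2 ^ i).-1.+1 = q.+1 * 2 ^ i by rewrite prednK // muln_gt0
  expn_gt0.
pose m := (q.+1 * 2 ^ i).-1.
exists (ncode3 (p * 2 ^ i) (n * 2 ^ i + q.+1) m),
  (ncode3 (p * 2 ^ i + q.+1) (n * 2 ^ i) m).
have E : (m.+1%:R = q.+1%:R * 2 ^+ i :> rat)%R by rewrite mE natrM natrX.
have h1 : (q.+1%:R : rat)%R != 0%R by rewrite pnatr_eq0.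
have h2 : (2 ^+ i : rat)%R != 0%R by rewrite expf_neq0.
split; [by do 3!eexists|by do 3!eexists| | |].
- rewrite !num_code3 E !natrD !natrM natrX.
  move: (_.+1%:R : rat)%R (2 ^+ i : rat)%R h1 h2 => x y h1 h2.
  by field; rewrite h1 h2.
- rewrite !num_code3 E !natrD !natrM natrX.
  move: (_.+1%:R : rat)%R (2 ^+ i : rat)%R h1 h2 => x y h1 h2.
  by field; rewrite h1 h2.
- use c_ball [:: p; n; q; i; m] => //; first by rewrite npair0 !addn1 mE eqxx.
  by rewrite [npair i 0]npair0 !addn1.
Qed.

Definition code_box (s : seq (nat * nat)) : nat :=
  CodeSeq.code [seq npair b.1 b.2 | b <- s].

Definition look_box (s : seq (nat * nat)) (x : nat) : nat :=
  look [seq npair b.1 b.2 | b <- s] x.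

Lemma dv_look s x : dv [:: tLook; code_box s; x; look_box s x].
Proof.
elim: s => [|[y J] s IH]; first by use c_look0 [:: x].
rewrite /look_box /= nhead_cons ntail_cons; case: eqP => [->|yx].
  by use c_look1 [:: x; J; code_box s].
use c_look2 [:: x; y; J; code_box s; look_box s x] => //.
by split; [apply: dv_neq => /esym|split].
Qed.

(** * Enclosures on boxes near a point *)

Section Completeness.
Variables (R : realType) (F : language R).
Variable mach : forall n : nat, symb F n -> otm.
Local Open Scope ring_scope.

(** Only nearness of the endpoints is asked, not that J contain a: certificates must exist on all
    boxes near a point, and membership matters for soundness alone. *)
Definition inside (eta : R) (J : nat) (a : R) : Prop := exists c d,
  [/\ J = npair c d, number c, number d,
      `|ratr (num c) - a| < eta & `|ratr (num d) - a| < eta].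

Definition close (eta : R) (s : seq (nat * nat)) (e : env R) : Prop :=
  forall x, inside eta (look_box s x) (e x).

Definition locally (e : env R) (P : seq (nat * nat) -> Prop) : Prop :=
  exists2 eta, 0 < eta & forall s, close eta s e -> P s.

Lemma insideW eta eta' J a : eta <= eta' -> inside eta J a -> inside eta' J a.
Proof.
move=> le [c [d [JE nc nd h1 h2]]]; exists c, d; split=> //;
  exact: lt_le_trans le.
Qed.

Lemma closeW eta eta' s e : eta <= eta' -> close eta s e -> close eta' s e.
Proof. by move=> le h x; apply: insideW (h x). Qed.

Lemma locally_imp e (P Q : seq (nat * nat) -> Prop) :
  (forall s, P s -> Q s) -> locally e P -> locally e Q.
Proof. by move=> PQ [eta e0 h]; exists eta => // s /h /PQ. Qed.

Lemma locally_and e (P Q : seq (nat * nat) -> Prop) :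
  locally e P -> locally e Q -> locally e (fun s => P s /\ Q s).
Proof.
move=> [a a0 ha] [b b0 hb]; exists (Num.min a b); first by rewrite lt_min a0.
move=> s hs; split; [apply: ha|apply: hb]; apply: closeW hs.
  by rewrite ge_min lexx.
by rewrite ge_min lexx orbT.
Qed.

Lemma close_nil eta : 0 < eta -> close eta [::] (fun=> 0).
Proof.
move=> h x; exists (ncode3 0 0 0), (ncode3 0 0 0).
by split=> //; [exact: number_zero|exact: number_zero|..];
  rewrite num_zero rmorph0 subrr normr0.
Qed.

Lemma close_upd eta s e x J a :
  close eta s e -> inside eta J a -> close eta ((x, J) :: s) (upd e x a).
Proof.
move=> hs hJ y; rewrite /look_box /= nhead_cons ntail_cons /upd eq_sym.
by case: eqP => // _; apply: hs.
Qed.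

Lemma exp2_small (eps : R) : 0 < eps -> exists i, 2 ^- i < eps.
Proof.
move=> e0; exists (Num.bound eps^-1).
have h : eps^-1 < (2 ^ Num.bound eps^-1)%:R.
  apply: lt_trans (archi_boundP _) _; first by rewrite invr_ge0 ltW.
  by rewrite ltr_nat ltn_expl.
rewrite -[X in _ < X]invrK ltf_pV2 ?posrE ?invr_gt0 ?exprn_gt0 //.
by rewrite -natrX.
Qed.

Lemma number_between (x y : R) : x < y ->
  exists c, [/\ number c, x < ratr (num c) & ratr (num c) < y].
Proof.
move=> /rat_in_itvoo[q]; rewrite in_itv /= => /andP[h1 h2].
have [p [n [k E]]] := num_surj q.
by exists (ncode3 p n k); rewrite E; split=> //; exists p, n, k.
Qed.

Lemma exp2S (i : nat) : 2 ^- i.+1 + 2 ^- i.+1 = 2 ^- i :> R.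
Proof. by rewrite exprS invfM; lra. Qed.

(** The tolerance 2 ^- j is shared equally between the distance of the approximation from the point
    and that of the endpoints from the point. *)
Lemma dv_words Js xs qs j :
  List.Forall2 (inside (2 ^- j.+1)) Js xs ->
  List.Forall2 (fun q x => dyadic q /\ `|ratr q - x| < 2 ^- j.+1) qs xs ->
  dv [:: tWords; CodeSeq.code Js; j; CodeSeq.code (dwords qs)].
Proof.
move=> h; elim: h qs => [|J x Js' xs' [c [d [-> nc nd hc hd]]] _ IH] qs hq.
  by inversion hq; use c_words0 [:: j].
inversion hq as [|q x' qs' xs'' [dq qx] hqs]; subst.
have [n [nn nq hw]] := dv_word dq.
use c_words1 [:: c; d; CodeSeq.code Js'; j; CodeSeq.code (dwords (q :: qs')); n;
  CodeSeq.code (dwords qs')] => //.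
have nr b : `|ratr (num b) - x| < 2 ^- j.+1 -> number b -> dv [:: tNear; n; b; j].
  move=> hb nb; apply: dv_near => //; rewrite -(ratr_dist R) -exp2S nq.
  have -> : ratr q - ratr (num b) = (ratr q - x) - (ratr (num b) - x) :> R by
    ring.
  by apply: le_lt_trans (ler_normB _ _) _; apply: ltrD.
by do ![split; first by [apply: nr|apply: IH|apply: hw]].
Qed.

Lemma dv_oracle Js (orc : nat -> seq nat) m i :
  (forall j, (i <= j < i + m)%N ->
     dv [:: tWords; CodeSeq.code Js; j; CodeSeq.code (orc j)]) ->
  dv [:: tOracle; CodeSeq.code Js; i;
         CodeSeq.code [seq CodeSeq.code (orc j) | j <- iota i m]].
Proof.
elim: m i => [|m IH] i h; first by use c_oracle0 [:: CodeSeq.code Js; i].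
use c_oracle1 [:: CodeSeq.code Js; i; CodeSeq.code (orc i);
  CodeSeq.code [seq CodeSeq.code (orc j) | j <- iota i.+1 m]] => //.
split; first by apply: h; lia.
by split=> //; rewrite addn1; apply: IH => j hj; apply: h; lia.
Qed.

Lemma dv_encs e eps (ts : seq (term F)) :
  (forall t, List.In t ts -> locally e (fun s => exists2 J, inside eps J (tval
    e t)
     & dv [:: tEnc; code_box s; code_term mach t; J])) ->
  locally e (fun s => exists2 Js, List.Forall2 (inside eps) Js (map (tval e) ts)
     & dv [:: tEncs; code_box s; CodeSeq.code (map (code_term mach) ts);
              CodeSeq.code Js]).
Proof.
elim: ts => [_|t ts IH h].
  by exists 1 => // s _; exists [::]; [constructor|use c_encs0 [:: code_box s]].
have ht := h t (or_introl erefl).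
have {IH}hts := IH (fun t' ht' => h t' (or_intror ht')).
apply: locally_imp (locally_and ht hts) => s [[J JP dJ] [Js JsP dJs]].
exists (J :: Js); first by constructor.
by use c_encs1 [:: code_box s; code_term mach t; J;
  CodeSeq.code (map (code_term mach) ts); CodeSeq.code Js].
Qed.

Lemma Forall2_map (A B C : Type) (P : A -> B -> Prop) (f : C -> A) (g : C -> B)
  l :
  (forall z, P (f z) (g z)) -> List.Forall2 P (map f l) (map g l).
Proof. by move=> h; elim: l => [|z l IH] /=; constructor. Qed.

Lemma Forall2_imp (A B : Type) (P Q : A -> B -> Prop) l l' :
  (forall a b, P a b -> Q a b) -> List.Forall2 P l l' -> List.Forall2 Q l l'.
Proof. by move=> PQ; elim=> [|a b s s' /PQ h _ IH]; constructor. Qed.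

Hypothesis machP : forall (n : nat) (f : symb F n),
  type2_computes (mach f) (fdom f) (fval f).

Lemma dv_enc e (t : term F) : tdef e t -> forall eps, 0 < eps ->
  locally e (fun s => exists2 J, inside eps J (tval e t)
    & dv [:: tEnc; code_box s; code_term mach t; J]).
Proof.
elim: t => [x _|n f ts IH /= [dts dom]] eps e0.
  exists eps => // s hs; exists (look_box s x); first exact: hs.
  use c_enc_var [:: code_box s; x; look_box s x] => //.
  by split=> //; apply: dv_look.
set x := \row_i tval e (ts i) in dom *.
(* One bit more precise than a name requires, so that its words stay valid on a small interval
   around each argument. *)
have [y yP] := choice (fun ji : nat * 'I_n => dyadic_approx (x 0 ji.2) ji.1.+1).
pose g (j : nat) : 'rV[rat]_n := \row_i y (j, i).
have pos m : 0 < 2 ^- m :> R by rewrite invr_gt0 exprn_gt0.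
have gx : is_name x g.
  move=> j i; rewrite /g mxE; have [dy ny] := yP (j, i); split=> //.
  apply: lt_trans ny _; rewrite -(exp2S j) ltrDl.
  exact: pos.
have [i i0] := exp2_small e0.
(* Precision i + 1 because the error of q and the radius of the ball add up to 2 ^- i. *)
have [q [dq [k [c [kE cE]]] near]] := machP dom gx i.+1.
have [N hN] := dv_run kE.
(* The accuracy required of the arguments is known only now: the run at the point itself fixes the
   number N of words, and 2 ^- N.+1 suffices for all of them. *)
have hts : forall t, List.In t [seq ts i | i <- enum 'I_n] ->
    locally e (fun s => exists2 J, inside (2 ^- N.+1) J (tval e t)
      & dv [:: tEnc; code_box s; code_term mach t; J]).
  by elim: (enum 'I_n) => //= j s IHs t [<-|/IHs//]; apply: IH.
apply: locally_imp (dv_encs hts) => s [Js JsP dJs].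
have [nq [nnq nqE hw]] := dv_word dq.
have [lo [hi [nlo nhi loE hiE hb]]] := dv_ball i.+1 nnq.
exists (npair lo hi).
  have a0 := pos i.+1; exists lo, hi; split=> //.
  - rewrite loE nqE rmorphB fmorphV rmorphXn /= ratr_nat -[fval _ _]/(fval f x).
    apply: lt_trans i0; rewrite -(exp2S i); move: near; rewrite !ltr_norml.
    by move: (2 ^- i.+1) a0 => a a0 /andP[? ?]; apply/andP; split; lra.
  - rewrite hiE nqE rmorphD fmorphV rmorphXn /= ratr_nat -[fval _ _]/(fval f x).
    apply: lt_trans i0; rewrite -(exp2S i); move: near; rewrite !ltr_norml.
    by move: (2 ^- i.+1) a0 => a a0 /andP[? ?]; apply/andP; split; lra.
pose W := [seq CodeSeq.code (name_oracle g j) | j <- iota 0 N].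
use c_enc_app [:: code_box s; code_otm (mach f);
  CodeSeq.code [seq code_term mach (ts i) | i <- enum 'I_n]; npair lo hi;
  CodeSeq.code Js; CodeSeq.code W; i.+1; CodeSeq.code (nseq i.+1 1%N);
  CodeSeq.code (dyadic_word q); nq] => //.
split; first by rewrite -map_comp in dJs.
split.
  apply: dv_oracle => j; rewrite add0n => /andP[_ jN].
  have -> : name_oracle g j = dwords [seq g j 0 i | i <- enum 'I_n].
    by rewrite /name_oracle /dwords -map_comp.
  apply: (@dv_words Js [seq x 0 i | i <- enum 'I_n]).
    have -> : [seq x 0 i | i <- enum 'I_n] = map (tval e) [seq ts i | i <- enum
      'I_n].
      by rewrite -map_comp; apply: eq_map => z /=; rewrite mxE.
    apply: Forall2_imp JsP => J z; apply: insideW.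
    by rewrite lef_pV2 ?posrE ?exprn_gt0 // ler_weXn2l // ?ltnS 1?ltnW // ler1n.
  by apply: Forall2_map => z; rewrite /g mxE; apply: (yP (j, z)).
split; first exact: dv_ones.
split.
  rewrite -cE; apply: hN => [|j jN]; first by rewrite size_map size_iota.
  by rewrite (nth_map 0%N) ?size_iota // nth_iota.
split; first by have := hw [::]; rewrite cats0.
by split.
Qed.

(** * The two strict verdicts and their certificates *)

Fixpoint strict_matrix (d : R) (pol : bool) (e : env R) (p : formula F) : Prop :=
  match p with
  | Gt0 t | Ge0 t => if pol then tval e t < d else 0 < tval e t
  | And p q =>
      if pol then strict_matrix d pol e p \/ strict_matrix d pol e q
      else strict_matrix d pol e p /\ strict_matrix d pol e q
  | Or p q =>
      if pol then strict_matrix d pol e p /\ strict_matrix d pol e q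
      else strict_matrix d pol e p \/ strict_matrix d pol e q
  | Ex _ _ | All _ _ => False
  end.

(* Polarity false: the sentence holds with every atom made strict.  Polarity
   true: the negation of the d-strengthening does. *)
Fixpoint strict (d : R) (pol : bool) (e : env R) (b : bform F) : Prop :=
  match b with
  | Matrix p => strict_matrix d pol e p
  | QEx x u v b1 =>
      if pol then forall a, tval e u <= a <= tval e v -> strict d pol (upd e x
        a) b1
      else exists2 a, tval e u <= a <= tval e v & strict d pol (upd e x a) b1
  | QAll x u v b1 =>
      if pol then exists2 a, tval e u <= a <= tval e v & strict d pol (upd e x
        a) b1
      else forall a, tval e u <= a <= tval e v -> strict d pol (upd e x a) b1
  end.

Lemma strict_matrix_or d e p : 0 < d -> qfree p ->
  strict_matrix d false e p \/ strict_matrix d true e p.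
Proof.
move=> d0; elim: p => [t _|t _|p IHp q IHq /andP[/IHp ? /IHq ?]
  |p IHp q IHq /andP[/IHp ? /IHq ?]|//|//] /=; try tauto.
- by case: (ltP 0 (tval e t)) => h; [left|right; apply: le_lt_trans d0].
- by case: (ltP 0 (tval e t)) => h; [left|right; apply: le_lt_trans d0].
Qed.

(** By excluded middle either a witness for one polarity exists, or every point of the interval
    lacks it and the induction hypothesis gives the other polarity there. This classical step only
    proves that a certificate exists; the search does not use it. *)
Lemma strict_or d e b : 0 < d -> bform_wf b ->
  strict d false e b \/ strict d true e b.
Proof.
move=> d0; elim: b e => [p|x u v b IH|x u v b IH] e /=;
  first exact: strict_matrix_or.
  move=> [_ /IH{}IH].
  have [?|h] := pselect (exists2 a, tval e u <= a <= tval e v &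
    strict d false (upd e x a) b); [by left|right=> a ha].
  by case: (IH (upd e x a)) => // hs; case: h; exists a.
move=> [_ /IH{}IH].
have [?|h] := pselect (exists2 a, tval e u <= a <= tval e v &
  strict d true (upd e x a) b); [by right|left=> a ha].
by case: (IH (upd e x a)) => // hs; case: h; exists a.
Qed.

Section Derivations.
Variables (dl : nat) (pol : bool).
Hypothesis dlP : number dl.

Lemma dv_matrix e p : qfree p -> matrix_def e p ->
  strict_matrix (ratr (num dl)) pol e p ->
  locally e (fun s => dv [:: tMatrix; pol : nat; dl; code_box s;
    code_formula mach p]).
Proof.
have atom t : tdef e t ->
    (if pol then tval e t < ratr (num dl) else 0 < tval e t) ->
    locally e (fun s => exists c d, dv [:: tEnc; code_box s; code_term mach t;
      npair c d]
      /\ dv (if pol then [:: tLt; d; dl] else [:: tLt; ncode3 0 0 0; c])).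
  move=> dt; case: pol => h.
    (* The tolerance is the distance of the value from the threshold, so the relevant endpoint stays
       on the right side; for the other polarity it is the value itself. *)
    have := dv_enc dt (eps := ratr (num dl) - tval e t); rewrite subr_gt0.
    move=> /(_ h); apply: locally_imp => s [J [c [d [-> nc nd h1 h2]]] dJ].
    exists c, d; split=> //; apply: dv_lt => //; rewrite -(ltr_rat R).
    by move: h2; rewrite ltr_norml => /andP[_]; rewrite ltrBlDr subrK.
  have := dv_enc dt h; apply: locally_imp => s [J [c [d [-> nc nd h1 h2]]] dJ].
  exists c, d; split=> //; apply: dv_lt => //; first exact: number_zero.
  rewrite num_zero -(ltr_rat R) rmorph0.
  by move: h1; rewrite ltr_norml => /andP[]; rewrite ltrBrDr addNr.
elim: p => [t _|t _|p IHp q IHq /andP[/IHp{}IHp /IHq{}IHq] [/IHp{}IHp /IHq{}IHq]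
  |p IHp q IHq /andP[/IHp{}IHp /IHq{}IHq] [/IHp{}IHp /IHq{}IHq]|//|//] /=.
- move=> /atom /[apply]; apply: locally_imp => s [c [d [h1 h2]]].
  case: pol h2 => h2.
    by use (c_atom 1 0) [:: dl; code_box s; code_term mach t; c; d].
  by use (c_atom 0 0) [:: dl; code_box s; code_term mach t; c; d].
- move=> /atom /[apply]; apply: locally_imp => s [c [d [h1 h2]]].
  case: pol h2 => h2.
    by use (c_atom 1 1) [:: dl; code_box s; code_term mach t; c; d].
  by use (c_atom 0 1) [:: dl; code_box s; code_term mach t; c; d].
- pose v s := [:: dl; code_box s; code_formula mach p; code_formula mach q].
  case: pol IHp IHq => IHp IHq [].
  + by move=> /IHp; apply: locally_imp => s h; use (c_left 1 2) (v s).
  + by move=> /IHq; apply: locally_imp => s h; use (c_right 1 2) (v s).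
  + move=> /IHp hp /IHq hq; apply: locally_imp (locally_and hp hq) => s [h1 h2].
    by use (c_both 0 2) (v s).
- pose v s := [:: dl; code_box s; code_formula mach p; code_formula mach q].
  case: pol IHp IHq => IHp IHq [].
  + move=> /IHp hp /IHq hq; apply: locally_imp (locally_and hp hq) => s [h1 h2].
    by use (c_both 1 3) (v s).
  + by move=> /IHp; apply: locally_imp => s h; use (c_left 0 3) (v s).
  + by move=> /IHq; apply: locally_imp => s h; use (c_right 0 3) (v s).
Qed.

Section Quantifiers.
Variables (e : env R) (x cb : nat) (u v : term F).
Hypotheses (du : tdef e u) (dw : tdef e v) (uv : tval e u <= tval e v).

Definition derives_at (a : R) : Prop := locally (upd e x a)
  (fun s => dv [:: tTrue; pol : nat; dl; code_box s; cb]).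

Lemma dv_some a : tval e u <= a <= tval e v -> derives_at a ->
  locally e (fun s => dv [:: tTrue; pol : nat; dl; code_box s;
    CodeSeq.code [:: if pol then 2 else 1; x; code_term mach u;
      code_term mach v; cb]]).
Proof.
move=> /andP[ua av] [eta eta0 ha].
have [lo [nlo lo1 lo2]] : exists c, [/\ number c, a - eta < ratr (num c)
    & ratr (num c) < a] by apply: number_between; lra.
have [hi [nhi hi1 hi2]] : exists c, [/\ number c, a < ratr (num c)
    & ratr (num c) < a + eta] by apply: number_between; lra.
have J : inside eta (npair lo hi) a.
  exists lo, hi; split=> //; rewrite ltr_norml; apply/andP; split; lra.
(* Since u <= a, enclosing u within hi - a keeps its upper endpoint below hi; symmetrically for v
   and lo. *)
have hu := dv_enc du (eps := ratr (num hi) - a).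
have hv := dv_enc dw (eps := a - ratr (num lo)).
rewrite subr_gt0 in hu; rewrite subr_gt0 in hv.
have {}ha : locally e (fun s => dv [:: tTrue; pol : nat; dl;
    npair (npair x (npair lo hi)) (code_box s); cb]).
  by exists eta => // s hs; apply: (ha ((x, npair lo hi) :: s)); apply: close_upd.
apply: locally_imp (locally_and ha (locally_and (hu hi1) (hv lo2))) => s.
move=> [hs [[_ [c [c' [-> nc nc' _ c1]]] dc] [_ [d' [d [-> nd' nd d1 _]]] dd]]].
pose w := [:: dl; code_box s; x; code_term mach u; code_term mach v; cb;
  c; c'; d'; d; lo; hi].
have pr : foldr (fun b P => dv (map (eval (nth 0%N w)) b) /\ P) True
    (premises (c_some pol (if pol then 2 else 1))).
  split=> //=; split=> //; split; first by apply: dv_le => //;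
    rewrite -(ler_rat R); lra.
  split.
    apply: dv_le => //; rewrite -(ler_rat R); move: c1;
      rewrite ltr_norml => /andP[_ ?].
    by lra.
  split=> //.
  apply: dv_le => //; rewrite -(ler_rat R); move: d1;
    rewrite ltr_norml => /andP[? _].
  by lra.
move: pr; case: (pol) => pr.
  by apply: (@infer (c_some 1 2) w) => //; in_prog.
by apply: (@infer (c_some 0 1) w) => //; in_prog.
Qed.

Lemma derives_interval a : derives_at a -> exists2 eta, 0 < eta &
  forall c d s, number c -> number d -> `|ratr (num c) - a| < eta ->
  `|ratr (num d) - a| < eta -> close eta s e ->
  dv [:: tTrue; pol : nat; dl; npair (npair x (npair c d)) (code_box s); cb].
Proof.
move=> [eta eta0 h]; exists eta => // c d s nc nd hc hd hs.
by apply: (h ((x, npair c d) :: s)); apply: close_upd => //; exists c, d.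
Qed.

(** The cover must start strictly left of z and end strictly right of v: this openness carries the
    property to points below z and leaves room for enclosures of u and v. *)
Definition covered (z : R) : Prop := exists c d,
  [/\ number c, number d, ratr (num c) < z, tval e v < ratr (num d) &
      locally e (fun s => dv [:: tCover; pol : nat; dl; code_box s; x;
        npair c d; cb])].

Lemma cover_single c d s :
  dv [:: tTrue; pol : nat; dl; npair (npair x (npair c d)) (code_box s); cb] ->
  dv [:: tCover; pol : nat; dl; code_box s; x; npair c d; cb].
Proof.
case: pol => h.
  by use (c_cover0 1) [:: dl; code_box s; x; npair c d; 0; cb]%N.
by use (c_cover0 0) [:: dl; code_box s; x; npair c d; 0; cb]%N.
Qed.

Lemma cover_step c c' d s :
  dv [:: tTrue; pol : nat; dl; npair (npair x (npair c c')) (code_box s); cb] ->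
  dv [:: tCover; pol : nat; dl; code_box s; x; npair c' d; cb] ->
  dv [:: tCover; pol : nat; dl; code_box s; x; npair c d; cb].
Proof.
case: pol => h h'.
  by use (c_cover1 1) [:: dl; code_box s; x; 0; 0; cb; c; c'; 0; d]%N.
by use (c_cover1 0) [:: dl; code_box s; x; 0; 0; cb; c; c'; 0; d]%N.
Qed.

(* Compactness of [u, v]: the infimum of the covered points is covered, and so
   are the points slightly below it. *)
Lemma covered_all : (forall a, tval e u <= a <= tval e v -> derives_at a) ->
  covered (tval e u).
Proof.
move=> h; set U := tval e u in h *; set V := tval e v in h *.
pose S : set R := [set z | U <= z <= V /\ covered z]%classic.
have SV : S V.
  split; first by rewrite uv lexx.
  have [|eta eta0 hd] := derives_interval (h V _); first by rewrite uv lexx.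
  have [c [nc c1 c2]] : exists c, [/\ number c, V - eta < ratr (num c)
      & ratr (num c) < V] by apply: number_between; lra.
  have [d [nd d1 d2]] : exists c, [/\ number c, V < ratr (num c)
      & ratr (num c) < V + eta] by apply: number_between; lra.
  exists c, d; split=> //; exists eta => // s hs; apply: cover_single.
  by apply: hd => //; rewrite ltr_norml; apply/andP; split; lra.
have lbS : has_lbound S by exists U => z [/andP[]].
set m := inf S.
have Um : U <= m by apply: lb_le_inf; [exists V|move=> z [/andP[]]].
have mV : m <= V by apply: ge_inf.
have [|eta eta0 hm] := derives_interval (h m _); first by rewrite Um.
(* A covered point z so close to the infimum m that its cover starts at some c' < m + eta. *)
have [z [/andP[Uz zV] [c' [d [nc' nd c'z Vd hc']]]] zm] :
  exists2 z, S z & z < m + eta by apply: inf_adherent => //; split; [exists V|].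
have [c [nc c1 c2]] : exists c, [/\ number c, m - eta < ratr (num c)
    & ratr (num c) < m] by apply: number_between; lra.
have [c0 [nc0 c0m hc0]] : exists c0, [/\ number c0, ratr (num c0) < m &
    locally e (fun s => dv [:: tCover; pol : nat; dl; code_box s; x;
      npair c0 d; cb])].
  (* If that cover does not yet start left of m, then c' is within eta of m and the interval [c, c']
     can be put in front. *)
  have [c'm|mc'] := ltP (ratr (num c')) m; first by exists c'.
  exists c; split=> //.
  have hT : locally e (fun s => dv [:: tTrue; pol : nat; dl;
      npair (npair x (npair c c')) (code_box s); cb]).
    exists eta => // s hs; apply: hm => //; rewrite ltr_norml; apply/andP;
      split; lra.
  apply: locally_imp (locally_and hT hc') => s [h1 h2]; exact: cover_step h1 h2.
have [c0U|Uc0] := ltP (ratr (num c0)) U; first by exists c0, d.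
(* The cover starting at c0 also covers this midpoint, which lies in [u, v] below the infimum. *)
exfalso; pose z' := (ratr (num c0) + m) / 2.
have z'm : z' < m by rewrite /z'; lra.
have Sz' : S z'.
  split; first by apply/andP; split; rewrite /z'; lra.
  by exists c0, d; split=> //; rewrite /z'; lra.
by have := ge_inf lbS Sz'; rewrite -/m leNgt z'm.
Qed.

Lemma dv_every :
  (forall a, tval e u <= a <= tval e v -> derives_at a) ->
  locally e (fun s => dv [:: tTrue; pol : nat; dl; code_box s;
    CodeSeq.code [:: if pol then 1 else 2; x; code_term mach u;
      code_term mach v; cb]]).
Proof.
move=> /covered_all[lo [hi [nlo nhi loU Vhi hc]]].
(* The strict margins lo < u and v < hi are the tolerances that keep the enclosures of u and v
   between lo and hi. *)
have hu := dv_enc du (eps := tval e u - ratr (num lo)).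
have hv := dv_enc dw (eps := ratr (num hi) - tval e v).
rewrite subr_gt0 in hu; rewrite subr_gt0 in hv.
apply: locally_imp (locally_and hc (locally_and (hu loU) (hv Vhi))) => s.
move=> [hs [[_ [c [c' [-> nc nc' c1 _]]] dc] [_ [d' [d [-> nd' nd _ d1]]] dd]]].
pose w := [:: dl; code_box s; x; code_term mach u; code_term mach v; cb;
  c; c'; d'; d; lo; hi].
have pr : foldr (fun b P => dv (map (eval (nth 0%N w)) b) /\ P) True
    (premises (c_every pol (if pol then 1 else 2))).
  split=> //=; split=> //; split.
    apply: dv_le => //; rewrite -(ler_rat R); move: c1;
      rewrite ltr_norml => /andP[? _].
    by lra.
  split=> //.
  apply: dv_le => //; rewrite -(ler_rat R); move: d1;
    rewrite ltr_norml => /andP[_ ?].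
  by lra.
move: pr; case: (pol) => pr.
  by apply: (@infer (c_every 1 1) w) => //; in_prog.
by apply: (@infer (c_every 0 2) w) => //; in_prog.
Qed.

End Quantifiers.

End Derivations.

Lemma dv_true dl (pol : bool) e b : number dl -> meaningful_at e b ->
  strict (ratr (num dl)) pol e b ->
  locally e (fun s => dv [:: tTrue; pol : nat; dl; code_box s;
    code_bform mach b]).
Proof.
move=> ndl; elim: b e => [p|x u v b IH|x u v b IH] e [wf td pr].
- move=> /(dv_matrix ndl wf td); apply: locally_imp => s; case: pol => h.
    by use (c_matrix 1) [:: dl; code_box s; code_formula mach p].
  by use (c_matrix 0) [:: dl; code_box s; code_formula mach p].
- case: wf td pr => _ wf [du dw td] [uv pr].
  have D a : tval e u <= a <= tval e v -> strict (ratr (num dl)) pol (upd e x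
    a) b ->
      derives_at dl pol e x (code_bform mach b) a.
    by move=> ha; apply: IH; split; [exact: wf|exact: td|exact: pr].
  case: pol D {IH} => D => [h|[a ha h]].
    by apply: (dv_every du dw uv) => a ha; apply: D => //; apply: h.
  exact: (dv_some du dw ha (D a ha h)).
- case: wf td pr => _ wf [du dw td] [uv pr].
  have D a : tval e u <= a <= tval e v -> strict (ratr (num dl)) pol (upd e x
    a) b ->
      derives_at dl pol e x (code_bform mach b) a.
    by move=> ha; apply: IH; split; [exact: wf|exact: td|exact: pr].
  case: pol D {IH} => D => [[a ha h]|h].
    exact: (dv_some du dw ha (D a ha h)).
  by apply: (dv_every du dw uv) => a ha; apply: D => //; apply: h.
Qed.

(** The empty box confines all variables to 0, hence is close to the zero environment at every
    tolerance; the local statement of [dv_true] applies to it. *)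
Lemma dv_answer b d : bform_wf b -> meaningful b -> 0 < d ->
  exists z, dv [:: tAnswer; code_bform mach b; code_rat d; z].
Proof.
move=> wf [td pr] d0; have [m [k [dE dnum]]] := code_rat_pos d0.
have ndl : number (ncode3 m 0 k) by exists m, 0%N, k.
have mb : meaningful_at (fun=> 0) b by split.
have dR : 0 < ratr (num (ncode3 m 0 k)) :> R by rewrite -dnum ltr0q.
have [h|h] := strict_or (fun=> 0) dR wf.

  have [eta eta0 /(_ [::] (close_nil eta0)) hd] := dv_true ndl mb h.
  by exists 1%N; use c_answer1 [:: code_bform mach b; code_rat d; ncode3 m 0 k].
have [eta eta0 /(_ [::] (close_nil eta0)) hd] := dv_true ndl mb h.
exists 0%N; use c_answer0 [:: code_bform mach b; m; k] => //.
by rewrite dE addn1.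
Qed.

End Completeness.

(** * The decision procedure *)

Local Open Scope ring_scope.

Theorem theorem23 (R : realType) (F : language R)
    (mach : forall n : nat, symb F n -> otm)
    (machP : forall (n : nat) (f : symb F n),
       type2_computes (mach n f) (fdom f) (fval f)) :
  exists alg : recfun,
    forall (phi : bform F) (delta : rat),
      bounded_sentence phi -> meaningful phi -> 0 < delta ->
      exists answer : bool,
        reval alg [:: code_bform mach phi; code_rat delta] (nat_of_bool answer)
        /\ (if answer then bform_true phi
            else ~ bform_true (strengthen delta phi)).
Proof.
have [alg algP] := derivable_search prog tAnswer.
exists alg => phi delta [wf _] mf d0.
(* Completeness only makes the search halt. The answer found may differ from the one whose
   certificate was constructed, so its correctness is taken from soundness. *)
have [z dz zE] := algP _ _ (dv_answer machP wf mf d0).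
have sz : s_answer mach (code_bform mach phi) (code_rat delta) z :=
  derivable_sem machP dz.
have [[z1 h]|[z0 h]] := sz phi delta erefl erefl d0 wf mf.
  by exists true; split=> //; rewrite z1 in zE.
by exists false; split=> //; rewrite z0 in zE.
Qed.
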